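(* For every $m\ge 5$ we have $p_c(G(m))\le p_h$, where $$p_h=\sup\left\{p\in[0,1/2] : D(p)+p-\frac{2}{m}=0\right\}$$ and $$D(p)=\frac{2}{m}\sum_{C\in\mathcal{C}(v)}\frac{1}{|V(C)|}\left(p^{|E(C)|}(1-p)^{|\partial(C)|}-(1-p)^{|E(C)|}p^{|\partial(C)|}\right),$$ where $\mathcal{C}(v)$ denotes the set of finite connected subgraphs $C$ of $G(m)$ containing a fixed vertex $v$ of the graph $G(m)$.
   Context: For $m\ge 5$, $G(m)$ is the infinite planar graph that is $m$-regular and tiles the (hyperbolic) plane by faces of length $m$. In bond percolation with parameter $p\in[0,1]$, each edge is independently open with probability $p$ and closed otherwise. For a fixed edge $e$ of $G(m)$, let $f(p)$ be the probability that $e$ belongs to an infinite connected component of the open subgraph (independent of $e$ by edge-transitivity). The critical probability $p_c(G(m))$ is the supremum of the set of $p$ with $f(p)=0$. A subgraph $C$ of $G(m)$ is any set of vertices $V(C)$ together with any set of edges $E(C)$ with endpoints in $V(C)$ (not necessarily induced; the single vertex $v$ with no edges is allowed). $\partial(C)$ is the set of edges of $G(m)$ that have at least one endpoint in $V(C)$ and do not belong to $E(C)$. The convention $0^0=1$ is used. *)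

(* Defs.v *)
From HB Require Import structures.
From mathcomp Require Import all_boot all_order all_algebra finmap.
From mathcomp Require Import all_classical all_reals all_analysis.

Set Implicit Arguments.
Unset Strict Implicit.
Unset Printing Implicit Defensive.

Import Order.TTheory GRing.Theory Num.Theory.

Local Open Scope classical_set_scope.
Local Open Scope card_scope.
Local Open Scope ring_scope.

Record graph := Graph {
  vertex :> choiceType;
  adj : rel vertex;
  adj_sym : symmetric adj;
  adj_irrefl : irreflexive adj }.

(* A walk is a pair (x, s) of a start vertex x and the sequence s of the
   vertices visited after x, so that [path (adj G) x s] holds. *)

Section Tiling.
Variables (G : graph) (rot : G -> G -> G).

(* A rotation system on G is given by rot: rot x y is the neighbour of x that
   follows y in the cyclic order around x.  The oriented edge (x, y) is followed
   by face_step (x, y) on the boundary of the face lying on a fixed side of it,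
   so the faces are the orbits of face_step. *)
Definition face_step (d : G * G) : G * G := (d.2, rot d.2 d.1).

(* For a face of length m, the closed walk from y around the face that begins
   with the oriented edge (y, z), without its start vertex y. *)
Definition face_walk (m : nat) (y z : G) : seq G :=
  [seq d.2 | d <- traject face_step (y, z) m].

Definition rotation_system : Prop :=
  (forall x y : G, adj x y -> adj x (rot x y)) /\
  (forall x y z : G, adj x y -> adj x z -> exists k, iter k (rot x) y = z).

Definition faces_of_length (m : nat) : Prop :=
  forall x y : G, adj x y ->
    iter m face_step (x, y) = (x, y) /\
    (forall k, (0 < k < m)%N -> iter k face_step (x, y) <> (x, y)).

(* Homotopy, with fixed end points, of walks starting at x in the cell complex
   obtained by gluing a disc along each face (all of length m). *)
Inductive homotopic (m : nat) (x : G) : seq G -> seq G -> Prop :=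
| homotopic_refl s : homotopic m x s s
| homotopic_sym s t : homotopic m x s t -> homotopic m x t s
| homotopic_trans s t u :
    homotopic m x s t -> homotopic m x t u -> homotopic m x s u
| homotopic_backtrack s t z : adj (last x s) z ->
    homotopic m x (s ++ [:: z; last x s] ++ t) (s ++ t)
| homotopic_face s t z : adj (last x s) z ->
    homotopic m x (s ++ face_walk m (last x s) z ++ t) (s ++ t).

Definition simply_connected_complex (m : nat) : Prop :=
  forall (x : G) (s : seq G), path (@adj G) x s -> last x s = x ->
    homotopic m x s [::].

End Tiling.

(* G is the graph of a tiling of the plane by faces of length m with m faces
   around each vertex.  A rotation system turns a connected graph with finite
   degrees and finite faces into a cell decomposition of a surface without
   boundary; this surface is the plane exactly when it is simply connected and
   not compact, i.e. when moreover G is infinite. *)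
Definition regular_plane_tiling (m : nat) (G : graph) : Prop :=
  [/\ infinite_set [set: G],
      (forall x y : G, exists s, path (@adj G) x s /\ last x s = y),
      (forall x : G, [set y | adj x y] #= `I_m) &
      exists rot : G -> G -> G,
        [/\ rotation_system rot, faces_of_length rot m &
            simply_connected_complex rot m]].

Definition edge_set (G : graph) : set (set G) :=
  [set e | exists x y, adj x y /\ e = [set x; y]].

Definition edge (G : graph) : Type := set_type (@edge_set G).
HB.instance Definition _ (G : graph) := Choice.on (edge G).

Definition endpoints (G : graph) (e : edge G) : set G := val e.

Definition joined (G : graph) (F : set (edge G)) : rel G :=
  fun x y => `[< exists2 e, F e & endpoints e = [set x; y] >].

Definition reachable (G : graph) (F : set (edge G)) (x y : G) : Prop :=
  exists s, path (joined F) x s /\ last x s = y.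

(* Bond percolation.  A configuration is the set of open edges. *)

Definition open_edge (G : graph) (e : edge G) : set (set (edge G)) :=
  [set w | w e].

Definition config (G : graph) :=
  g_sigma_algebraType (range (@open_edge G)).

Definition bernoulli_percolation (R : realType) (G : graph) (p : R)
    (P : probability (config G) R) : Prop :=
  (forall e : edge G, P (open_edge e) = p%:E) /\
  (forall s : seq (edge G), uniq s ->
     P (\bigcap_(e in [set` s]) open_edge e) =
     (\prod_(e <- s) P (open_edge e))%E).

Definition in_infinite_component (G : graph) (e : edge G) : set (config G) :=
  [set w : set (edge G) | w e /\
     exists2 x, endpoints e x & infinite_set [set y | reachable w x y]].

(* P p is the percolation measure of parameter p. *)
Definition percolation_prob (R : realType) (G : graph)
    (P : R -> probability (config G) R) (e : edge G) (p : R) : R :=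
  fine (P p (in_infinite_component e)).

Definition critical_prob (R : realType) (G : graph)
    (P : R -> probability (config G) R) (e : edge G) : R :=
  sup [set p | 0 <= p <= 1 /\ percolation_prob P e p = 0].

(* A subgraph C is given by its vertex set C.1 and its edge set C.2. *)

Definition subgraph (G : graph) : Type := (set G * set (edge G))%type.
HB.instance Definition _ (G : graph) := Choice.on (subgraph G).

Definition finite_connected_subgraphs (G : graph) (v : G) :
    set (subgraph G) :=
  [set C | [/\ C.1 v,
               (forall e, C.2 e -> endpoints e `<=` C.1),
               finite_set C.1,
               finite_set C.2 &
               (forall x y, C.1 x -> C.1 y -> reachable C.2 x y)]].

Definition boundary (G : graph) (C : subgraph G) : set (edge G) :=
  [set e | (exists2 x, C.1 x & endpoints e x) /\ ~ C.2 e].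

Definition fin_card (T : choiceType) (A : set T) : nat := #|` fset_set A|.

Definition D_term (R : realType) (G : graph) (p : R) (C : subgraph G) : R :=
  (fin_card C.1)%:R^-1 *
  (p ^+ fin_card C.2 * (1 - p) ^+ fin_card (boundary C)
   - (1 - p) ^+ fin_card C.2 * p ^+ fin_card (boundary C)).

(* The sum of a family of real numbers of arbitrary sign is the sum of its
   positive parts minus the sum of its negative parts. *)
Definition real_sum (R : realType) (T : choiceType) (A : set T) (a : T -> R)
    : R :=
  fine (\esum_(x in A) (EFin \o a)^\+ x - \esum_(x in A) (EFin \o a)^\- x)%E.

Definition D (R : realType) (m : nat) (G : graph) (v : G) (p : R) : R :=
  2 / m%:R * real_sum (finite_connected_subgraphs v) (D_term p).

Definition p_h (R : realType) (m : nat) (G : graph) (v : G) : R :=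
  sup [set p : R | 0 <= p <= 2^-1 /\ D m v p + p - 2 / m%:R = 0].

(* Main.v *)
(* Cut edges into darts: primal clusters live on the orbits of the rotation,
   dual clusters (made of the closed edges) on the orbits of the face
   permutation.  Suppose that all open clusters are finite.  Over F_2, the finite
   even sets of open edges are exactly the boundaries of the finite unions of
   finite dual clusters, and each finite dual cluster L has its outer boundary in
   exactly one open cluster K.  The number of such L for a given K is the cycle
   rank |E(K)| - |V(K)| + 1 of K.  Sending mass from K to these L (the
   automorphism group acts simply transitively on darts) gives
   kappa(p) - kappa(1 - p) = 1 - m p / 2, where kappa(p) is the expected inverse
   size of the cluster of v and the dual clusters have been transported back to
   G(m) by self-duality.  This says D(p) + p - 2/m = 0 whenever f(p) = 0.
   If f(p) = 0 for some p > 1/2, thinning gives f(1/2) = 0, and the identity at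
   1/2 forces m = 4. *)
Require Import Defs.
From HB Require Import structures.
From mathcomp Require Import all_boot all_order all_algebra finmap.
From mathcomp Require Import all_classical all_reals all_analysis.
From mathcomp Require Import measurable_realfun zify ring lra.
Set Implicit Arguments.
Unset Strict Implicit.
Unset Printing Implicit Defensive.
Import Order.TTheory GRing.Theory Num.Theory.
Local Open Scope classical_set_scope.
Local Open Scope card_scope.
Local Open Scope ring_scope.

(** * Words in the triangle group *)

(** Jordan-type arguments are replaced by words in the rotation and the flip. Simple connectedness
    enters once, through [map_pres]: a word that fixes a dart is a consequence of the relators. This
    has three uses. The word action is free, which yields the automorphisms. The substitution
    exchanging the rotation with the face permutation respects the relators, which yields
    self-duality. Reading a trivial word as a mod 2 edge chain writes it as a sum of face
    boundaries, so finite cycles can be filled. Non-compactness enters only through the fact that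
    some edge leaves any nonempty finite union of faces; this makes the outer boundary of a dual
    cluster exist and be unique. Primal clusters are finite almost surely but dual ones may be
    infinite. Only the finite ones are counted, which matches the finite subgraphs summed in [D].
    Densities are compared additively in the extended reals, because finiteness of the dual density
    is itself a consequence of the identity. *)

Section Words.
Variable m : nat.
Hypothesis m_gt0 : (0 < m)%N.

(* Words in the rotation ([true]) and the flip ([false]) of darts. *)
Definition relators : seq (seq bool) :=
  [:: nseq m true; [:: false; false]; flatten (nseq m [:: false; true])].

Inductive eqw : seq bool -> seq bool -> Prop :=
| eqw_refl w : eqw w w
| eqw_sym w w' : eqw w w' -> eqw w' w
| eqw_trans w2 w1 w3 : eqw w1 w2 -> eqw w2 w3 -> eqw w1 w3
| eqw_relator u r v : r \in relators -> eqw (u ++ r ++ v) (u ++ v).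

Lemma eqw_ctx u v w w' : eqw w w' -> eqw (u ++ w ++ v) (u ++ w' ++ v).
Proof.
elim=> {w w'} [w|w w' _|w2 w1 w3 _ IH1 _ IH2|x r y rR].
- exact: eqw_refl.
- exact: eqw_sym.
- exact: eqw_trans IH1 IH2.
- by have := @eqw_relator (u ++ x) r (y ++ v) rR; rewrite -!catA.
Qed.

Lemma eqw_cat u u' v v' : eqw u u' -> eqw v v' -> eqw (u ++ v) (u' ++ v').
Proof.
move=> /(eqw_ctx [::] v) uu' /(eqw_ctx u' [::]); rewrite !cats0.
exact: eqw_trans.
Qed.

Lemma eqw_cons b w w' : eqw w w' -> eqw (b :: w) (b :: w').
Proof. by move=> /(eqw_ctx [:: b] [::]); rewrite !cats0. Qed.

Lemma eqw_relator_nil r : r \in relators -> eqw r [::].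
Proof. by move=> /(eqw_relator [::] [::]); rewrite /= cats0. Qed.

Lemma eqw_rot : eqw (nseq m true) [::].
Proof. by apply: eqw_relator_nil; rewrite !inE eqxx. Qed.

Lemma eqw_flip : eqw [:: false; false] [::].
Proof. by apply: eqw_relator_nil; rewrite !inE eqxx orbT. Qed.

Lemma eqw_face : eqw (flatten (nseq m [:: false; true])) [::].
Proof. by apply: eqw_relator_nil; rewrite !inE eqxx !orbT. Qed.

Lemma eqw_nseq_mod k l : k = l %[mod m] -> eqw (nseq k true) (nseq l true).
Proof.
have red n : eqw (nseq n true) (nseq (n %% m)%N true).
  rewrite {1}(divn_eq n m) addnC nseqD -[X in eqw _ X]cats0.
  apply: eqw_cat; first exact: eqw_refl.
  elim: (n %/ m)%N => [|q IH]; first exact: eqw_refl.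
  by rewrite mulSn nseqD -[X in eqw _ X]/([::] ++ [::]); apply: eqw_cat => //; exact: eqw_rot.
move=> kl; apply: eqw_trans (red k) _; rewrite kl; exact/eqw_sym/red.
Qed.

Fixpoint winv (w : seq bool) : seq bool :=
  if w is b :: w then winv w ++ (if b then nseq m.-1 true else [:: false])
  else [::].

Lemma eqw_winvr w : eqw (w ++ winv w) [::].
Proof.
elim: w => [|b w IH] /=; first exact: eqw_refl.
set v := if b then _ else _.
apply: (eqw_trans (w2 := [:: b] ++ v)).
  have -> : b :: w ++ winv w ++ v = [:: b] ++ (w ++ winv w) ++ v by rewrite -catA.
  exact: (eqw_ctx [:: b] v IH).
rewrite /v {v}; case: b => /=; last exact: eqw_flip.
by rewrite -[true :: _]/(nseq m.-1.+1 true) prednK //; exact: eqw_rot.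
Qed.

Lemma eqw_winvl w : eqw (winv w ++ w) [::].
Proof.
elim: w => [|b w IH] /=; first exact: eqw_refl.
rewrite -[b :: w]/([:: b] ++ w) -catA catA.
apply: (eqw_trans (w2 := winv w ++ w)) => //.
rewrite -catA; apply: eqw_cat; first exact: eqw_refl.
rewrite -[X in eqw _ X]/([::] ++ w) catA; apply: eqw_cat; last exact: eqw_refl.
case: b => /=; last exact: eqw_flip.
by rewrite -[[:: true]]/(nseq 1 true) -nseqD addn1 prednK //; exact: eqw_rot.
Qed.

Lemma eqw_cancel w w' : eqw (w' ++ winv w) [::] -> eqw w' w.
Proof.
move=> h; apply: (eqw_trans (w2 := (w' ++ winv w) ++ w)).
  rewrite -catA -{1}[w']cats0; apply: eqw_cat; first exact: eqw_refl.
  exact/eqw_sym/eqw_winvl.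
by rewrite -[X in eqw _ X]/([::] ++ w); apply: eqw_cat => //; exact: eqw_refl.
Qed.

Definition dual_word (w : seq bool) : seq bool :=
  flatten [seq if b then [:: false; true] else [:: false] | b <- w].

Lemma dual_word_cat u v : dual_word (u ++ v) = dual_word u ++ dual_word v.
Proof. by rewrite /dual_word map_cat flatten_cat. Qed.

(** The substitution sends the rotation relator to the face relator, fixes the flip relator, and
    turns the face relator into (AAS)^m, which reduces to S^m. *)
Lemma dual_word_eqw w w' : eqw w w' -> eqw (dual_word w) (dual_word w').
Proof.
elim=> {w w'} [w|w w' _|w2 w1 w3 _ IH1 _ IH2|x r y rR].
- exact: eqw_refl.
- exact: eqw_sym.
- exact: eqw_trans IH1 IH2.
rewrite !dual_word_cat; apply: eqw_cat; first exact: eqw_refl.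
rewrite -[X in eqw _ X]/([::] ++ _); apply: eqw_cat; last exact: eqw_refl.
move: rR; rewrite !inE => /or3P[]/eqP->.
- by rewrite /dual_word map_nseq; exact: eqw_face.
- exact: eqw_flip.
- apply: eqw_trans eqw_rot; elim: (m) => [|k IH] /=; first exact: eqw_refl.
  rewrite -[dual_word _]/([:: false; false] ++ true :: dual_word (flatten (nseq k [:: false; true]))).
  rewrite -[true :: nseq k true]/([::] ++ ([:: true] ++ _)).
  apply: eqw_cat; first exact: eqw_flip.
  by rewrite -cat1s; apply: eqw_cat => //; exact: eqw_refl.
Qed.

Lemma dual_wordK w : eqw (dual_word (dual_word w)) w.
Proof.
elim: w => [|b w IH]; first exact: eqw_refl.
rewrite -(cat1s b w) !dual_word_cat; apply: eqw_cat => //.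
case: b => /=; last exact: eqw_refl.
rewrite -[X in eqw X _]/([:: false; false] ++ [:: true]).
rewrite -[X in eqw _ X]/([::] ++ [:: true]).
by apply: eqw_cat; [exact: eqw_flip|exact: eqw_refl].
Qed.

End Words.

Section Action.
Variables (T : Type) (s a : T -> T).

Definition act (w : seq bool) (d : T) : T :=
  foldl (fun x b => if b : bool then s x else a x) d w.

Lemma act_cat u v d : act (u ++ v) d = act v (act u d).
Proof. exact: foldl_cat. Qed.

Lemma act_nseq k d : act (nseq k true) d = iter k s d.
Proof. by elim: k d => // k IH d; rewrite /= [LHS]IH -iterSr. Qed.

Lemma act_face k d :
  act (flatten (nseq k [:: false; true])) d = iter k (s \o a) d.
Proof. by elim: k d => // k IH d; rewrite /= [LHS]IH -iterSr. Qed.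

End Action.

(* Vertices, edges and faces are the orbits of the rotation [s], the flip [a]
   and [s \o a] on darts.  Simple connectedness is [map_pres]: the action of
   the triangle group <S, A | S^m, A^2, (AS)^m> on darts is free. *)
Record regular_map (m : nat) (T : countType) (s a : T -> T) : Prop := RegularMap {
  map_m : (1 < m)%N;
  map_aK : involutive a;
  map_a_neq : forall d, a d != d;
  map_s_iter : forall d, iter m s d = d;
  map_s_order : forall d k, (0 < k < m)%N -> iter k s d != d;
  map_face_iter : forall d, iter m (s \o a) d = d;
  map_conn : forall d d', exists w, act s a w d = d';
  map_pres : forall w d, act s a w d = d -> eqw m w [::];
  map_infinite : infinite_set [set: T] }.

(** * Automorphisms and self-duality of a regular map *)

Section Automorphisms.
Variables (m : nat) (T : countType) (s a : T -> T).
Hypothesis H : regular_map m s a.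

Let m_gt0 : (0 < m)%N. Proof. exact: ltnW (map_m H). Qed.

Lemma act_eqw w w' : eqw m w w' -> forall d, act s a w d = act s a w' d.
Proof.
elim=> {w w'} [//|w w' _ IH d|w2 w1 w3 _ IH1 _ IH2 d|x r y rR d].
- by rewrite IH.
- by rewrite IH1 IH2.
rewrite !act_cat; congr act; move: rR; rewrite !inE => /or3P[]/eqP->.
- by rewrite act_nseq (map_s_iter H).
- by rewrite /act /= (map_aK H).
- by rewrite act_face (map_face_iter H).
Qed.

Lemma act_winv w d : act s a (winv m w) (act s a w d) = d.
Proof. by rewrite -act_cat (act_eqw (eqw_winvr m_gt0 w)). Qed.

Lemma act_inj_eqw w w' d : act s a w d = act s a w' d -> eqw m w w'.
Proof.
move=> e; apply: (eqw_cancel m_gt0); apply: (map_pres H (d := d)).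
by rewrite act_cat e act_winv.
Qed.

Definition wordto (d d' : T) : seq bool := sval (cid (map_conn H d d')).

Lemma wordtoP d d' : act s a (wordto d d') d = d'.
Proof. exact: svalP (cid (map_conn H d d')). Qed.

(** The automorphism taking [d1] to [d2]. Freeness makes the value independent of the chosen word,
    and extending a word by a letter applies [s] or [a], so the map commutes with both. *)
Definition autom (d1 d2 d : T) : T := act s a (wordto d1 d) d2.

Lemma autom_act d1 d2 w : autom d1 d2 (act s a w d1) = act s a w d2.
Proof. by apply/act_eqw/(@act_inj_eqw _ _ d1); rewrite wordtoP. Qed.

Lemma automE d1 d2 : autom d1 d2 d1 = d2.
Proof. exact: (autom_act d1 d2 [::]). Qed.

Lemma autom_s d1 d2 d : autom d1 d2 (s d) = s (autom d1 d2 d).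
Proof.
move: (wordto d1 d) (wordtoP d1 d) => w <-; rewrite autom_act.
by have := autom_act d1 d2 (w ++ [:: true]); rewrite !act_cat.
Qed.

Lemma autom_a d1 d2 d : autom d1 d2 (a d) = a (autom d1 d2 d).
Proof.
move: (wordto d1 d) (wordtoP d1 d) => w <-; rewrite autom_act.
by have := autom_act d1 d2 (w ++ [:: false]); rewrite !act_cat.
Qed.

Lemma automK d1 d2 : cancel (autom d1 d2) (autom d2 d1).
Proof.
by move=> d; move: (wordto d1 d) (wordtoP d1 d) => w <-; rewrite !autom_act.
Qed.

(* The words act simply transitively on darts, so exchanging the rotation with
   the face permutation on words defines an isomorphism onto the dual map. *)
Definition dualize (d0 d : T) : T := act s a (dual_word (wordto d0 d)) d0.

Lemma dualize_act d0 w : dualize d0 (act s a w d0) = act s a (dual_word w) d0.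
Proof.
by apply/act_eqw/dual_word_eqw/(@act_inj_eqw _ _ d0); rewrite wordtoP.
Qed.

Lemma dualizeE d0 : dualize d0 d0 = d0.
Proof. exact: (dualize_act d0 [::]). Qed.

Lemma dualizeK d0 : involutive (dualize d0).
Proof.
move=> d; move: (wordto d0 d) (wordtoP d0 d) => w <-; rewrite !dualize_act.
exact/act_eqw/dual_wordK.
Qed.

Lemma dualize_s d0 d : dualize d0 (s d) = (s \o a) (dualize d0 d).
Proof.
move: (wordto d0 d) (wordtoP d0 d) => w <-; rewrite dualize_act.
have := dualize_act d0 (w ++ [:: true]).
by rewrite act_cat dual_word_cat act_cat.
Qed.

Lemma dualize_a d0 d : dualize d0 (a d) = a (dualize d0 d).
Proof.
move: (wordto d0 d) (wordtoP d0 d) => w <-; rewrite dualize_act.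
have := dualize_act d0 (w ++ [:: false]).
by rewrite act_cat dual_word_cat act_cat.
Qed.

End Automorphisms.

(** * The darts of a plane tiling *)

Section GraphWords.
Variables (m : nat) (G : graph) (rot : G -> G -> G).
Hypothesis m_gt1 : (1 < m)%N.
Hypothesis nbrs : forall x : G, [set y | adj x y] #= `I_m.
Hypothesis rotG : rotation_system rot.
Hypothesis facesG : faces_of_length rot m.
Hypothesis simpG : simply_connected_complex rot m.

Let m_gt0 : (0 < m)%N. Proof. exact: ltnW. Qed.

Definition rotate (d : G * G) : G * G := (d.1, rot d.1 d.2).
Definition flip (d : G * G) : G * G := (d.2, d.1).
Definition is_dart (d : G * G) := adj d.1 d.2.

Lemma rotate_dart d : is_dart d -> is_dart (rotate d).
Proof. exact: rotG.1. Qed.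

Lemma flip_dart d : is_dart d -> is_dart (flip d).
Proof. by rewrite /is_dart /= adj_sym. Qed.

Lemma iter_rotate k d : iter k rotate d = (d.1, iter k (rot d.1) d.2).
Proof. by elim: k => [|k IH]; [case: d|rewrite !iterS IH]. Qed.

Lemma iter_rot_adj k (x y : G) : adj x y -> adj x (iter k (rot x) y).
Proof. by move=> xy; elim: k => // k; apply: rotG.1. Qed.

(** Transitivity of [rot x] on the neighbours makes [y] periodic. Its orbit over the least period
    lists the neighbours without repetition, so this period is the degree [m]. *)
Lemma iter_rot_order (x y : G) : adj x y ->
  iter m (rot x) y = y /\ forall k, (0 < k < m)%N -> iter k (rot x) y != y.
Proof.
move=> xy.
have exq : exists k, (0 < k)%N && (iter k (rot x) y == y).
  have [k kP] := rotG.2 _ _ _ (rotG.1 _ _ xy) xy.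
  by exists k.+1; rewrite iterSr kP eqxx.
case: (ex_minnP exq) => q /andP[q0 /eqP qy] qmin.
have tr_uniq : uniq (traject (rot x) y q).
  apply/(uniqP y) => i j; rewrite !inE size_traject => iq jq.
  rewrite !nth_traject // => ij.
  wlog ltij : i j iq jq ij / (i <= j)%N.
    by move=> wl; case: (leqP i j) => [|/ltnW] h; [|symmetry]; exact: wl.
  apply/eqP; rewrite eqn_leq ltij /= leqNgt; apply/negP => ltij'.
  have := qmin (q - j + i)%N; rewrite iterD ij -iterD subnK ?qy ?eqxx ?andbT //; last exact: ltnW.
  by move=> /(_ ltac:(lia)); lia.
have nbrs_fin : finite_set [set y | adj x y] by exists m; exact: nbrs.
have mem z : (z \in traject (rot x) y q) = (z \in fset_set [set y | adj x y]).
  apply/trajectP/idP.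
    by move=> [i _ ->]; rewrite in_fset_set // inE; exact: iter_rot_adj.
  rewrite in_fset_set // inE => /= xz.
  have [k kz] := rotG.2 _ _ _ xy xz.
  exists (k %% q)%N; first by rewrite ltn_pmod.
  rewrite -kz {1}(divn_eq k q) addnC iterD; congr iter.
  by elim: (k %/ q)%N => // c IH; rewrite mulSn iterD IH.
have qm : q = m.
  have <- : #|` fset_set [set y | adj x y]| = m.
    by have /card_fset_set := nbrs x.
  rewrite cardfE cardE -(size_traject (rot x) y q) -[in RHS](size_map val).
  apply/perm_size/uniq_perm => //; first by rewrite map_inj_uniq ?enum_uniq //; exact: val_inj.
  move=> z; rewrite mem; apply/idP/mapP => [zN|[[u uN] _ ->]//].
  by exists [` zN]%fset; rewrite ?mem_enum.
by rewrite -qm; split=> // k /andP[k0 kq]; apply/negP => ky; have := qmin k; rewrite k0 ky; lia.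
Qed.

Lemma iter_rotate_m d : is_dart d -> iter m rotate d = d.
Proof. by case: d => x y xy; rewrite iter_rotate /= (iter_rot_order xy).1. Qed.

Lemma iter_rotate_neq d k : is_dart d -> (0 < k < m)%N -> iter k rotate d != d.
Proof.
case: d => x y xy km; rewrite iter_rotate xpair_eqE eqxx /=.
exact: (iter_rot_order xy).2.
Qed.

(** Translates words into walks in the format of [homotopic], with the start vertex [d.1] omitted.
    Rotations leave no trace, so a walk determines a word at best up to a final power of the
    rotation. *)
Fixpoint track (w : seq bool) (d : G * G) : seq G :=
  match w with
  | [::] => [::]
  | true :: w => track w (rotate d)
  | false :: w => d.2 :: track w (flip d)
  end.

Notation actG := (act rotate flip).

Lemma act_dart w d : is_dart d -> is_dart (actG w d).
Proof.
elim: w d => // -[] w IH d dd; apply: IH; [exact: rotate_dart|exact: flip_dart].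
Qed.

Lemma track_cat u v d : track (u ++ v) d = track u d ++ track v (actG u d).
Proof. by elim: u d => // -[] u IH d /=; rewrite IH. Qed.

Lemma track_path w d : is_dart d -> path (@adj G) d.1 (track w d).
Proof.
elim: w d => // -[] w IH d dd /=; first exact: (IH (rotate d) (rotate_dart dd)).
by apply/andP; split => //; exact: (IH (flip d) (flip_dart dd)).
Qed.

Lemma track_last w d : last d.1 (track w d) = (actG w d).1.
Proof. by elim: w d => // -[] w IH d /=; [exact: (IH (rotate d))|exact: (IH (flip d))]. Qed.

Lemma track_nseq k d : track (nseq k true) d = [::].
Proof. by elim: k d => // k IH d /=. Qed.

Lemma track_surj x y s : adj x y -> path (@adj G) x s ->
  exists w, track w (x, y) = s.
Proof.
elim: s x y => [|z s IH] x y xy /=; first by exists [::].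
move=> /andP[xz zs]; have [k kz] := rotG.2 _ _ _ xy xz.
have zx : adj z x by rewrite adj_sym.
have [w ws] := IH z x zx zs.
exists (nseq k true ++ false :: w).
by rewrite track_cat track_nseq act_nseq iter_rotate /= kz /flip /= ws.
Qed.

Lemma iter_rotate_mod d k : is_dart d -> iter k rotate d = d -> k = 0 %[mod m].
Proof.
move=> dd kd; rewrite mod0n; apply/eqP; rewrite eqn0Ngt; apply/negP => k0.
have : iter (k %% m) rotate d = d.
  rewrite -[RHS]kd {2}(divn_eq k m) addnC iterD; congr iter.
  by elim: (k %/ m)%N => // c IH; rewrite mulSn iterD -IH iter_rotate_m.
by apply/eqP/iter_rotate_neq => //; rewrite k0 ltn_pmod.
Qed.

(** A walk determines each run of rotations before a flip modulo [m], but not the run after the last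
    flip; hence [l]. The offset [k] lets the induction remove rotations from one word at a time. *)
Lemma track_eq_gen w w' d k : is_dart d -> track w d = track w' (iter k rotate d) ->
  exists l, eqw m (w ++ nseq l true) (nseq k true ++ w').
Proof.
elim: w d k w' => [|[] w IHw] d k w' dd.
- elim: w' k => [|[] w' IH] k //= e.
  + by exists k; rewrite cats0; exact: eqw_refl.
  + have [l el] := IH k.+1 e; exists l; apply: eqw_trans el _.
    by rewrite -cat_rcons -cats1 -[[:: true]]/(nseq 1 true) -nseqD addn1; exact: eqw_refl.
- move=> /= e.
  (* Removing a rotation from the first word turns the offset into k - 1, written [k + m.-1] modulo
     [m]. *)
  have [|l el] := IHw (rotate d) (k + m.-1)%N w' (rotate_dart dd).
    by rewrite -iterSr -addnS prednK // iterD iter_rotate_m.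
  exists l; apply: eqw_trans (eqw_cons true el) _.
  rewrite -[true :: _]/(nseq (k + m.-1).+1 true ++ w') -addnS prednK //.
  by apply: eqw_cat; [apply: eqw_nseq_mod; rewrite modnDr|exact: eqw_refl].
- elim: w' k => [|[] w' IH] k //= e.
  + have [l el] := IH k.+1 e; exists l; apply: eqw_trans el _.
    by rewrite -cat_rcons -cats1 -[[:: true]]/(nseq 1 true) -nseqD addn1; exact: eqw_refl.
  + case: e => e1 e2.
    (* Both flips record the same next vertex, so the offset [k] fixes [d] and is a multiple of
       [m]. *)
    have kd : iter k rotate d = d.
      by rewrite iter_rotate; move: e1; rewrite iter_rotate /= => <-; case: (d).
    rewrite kd in e2; have [l el] := IHw (flip d) 0%N w' (flip_dart dd) e2.
    have k0 := iter_rotate_mod dd kd.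
    exists l.
    apply: eqw_trans (eqw_cons false el) _.
    rewrite -[X in eqw _ X _]/([::] ++ _); apply: eqw_cat; last exact: eqw_refl.
    by apply: (@eqw_nseq_mod _ 0).
Qed.

Lemma homotopic_path x s t : homotopic rot m x s t ->
  path (@adj G) x s = path (@adj G) x t /\ last x s = last x t.
Proof.
elim=> {s t} [//|s t _ [-> ->]|s t u _ [-> ->] _ [-> ->]|s t z xz|s t z xz] //.
- by rewrite !cat_path !last_cat /= xz adj_sym xz.
- have fw : face_walk rot m (last x s) z =
      track (flatten (nseq m [:: false; true])) (last x s, z).
    rewrite /face_walk; elim: (m) (last x s, z) => //= k IH d; congr (_ :: _); exact: IH.
  have dd : is_dart (last x s, z) by [].
  rewrite !cat_path !last_cat fw; have := track_path (flatten (nseq m [:: false; true])) dd.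
  rewrite /= => ->; have := track_last (flatten (nseq m [:: false; true])) (last x s, z).
  by rewrite act_face /= => ->; rewrite (facesG xz).1 /=.
Qed.

Lemma track_eq w w' d : is_dart d -> track w d = track w' d ->
  exists l, eqw m (w ++ nseq l true) w'.
Proof. by move=> dd e; exact: (@track_eq_gen w w' d 0). Qed.

(** An elementary homotopy amounts to a flip or face relator, inserted between a turn towards the
    edge to [z] and the turn back. *)
Lemma homotopic_eqw x s t : homotopic rot m x s t ->
  forall y w w', adj x y -> path (@adj G) x s ->
    track w (x, y) = s -> track w' (x, y) = t ->
  exists k, eqw m (w ++ nseq k true) w'.
Proof.
(* Only the tracks of [w] and [w'] are prescribed, so they may be compared through convenient words
   with the same tracks. *)
have via y v v' w w' : adj x y -> track w (x, y) = track v (x, y) ->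
    track w' (x, y) = track v' (x, y) -> eqw m v v' ->
    exists k, eqw m (w ++ nseq k true) w'.
  move=> xy e e' vv'; have [k kP] := @track_eq w v (x, y) xy e.
  have [l lP] := @track_eq v' w' (x, y) xy (esym e').
  exists (k + l)%N; rewrite nseqD catA; apply: eqw_trans lP.
  by apply: eqw_cat; [exact: eqw_trans kP vv'|exact: eqw_refl].
elim=> {s t} [s|s t _ IH|s u t su IH1 ut IH2|s t z xz|s t z xz] y w w' xy xs ws w's.
- by apply: (@track_eq _ _ (x, y)) => //; rewrite ws.
- have xt : path (@adj G) x s.
    by rewrite -w's; exact: (@track_path _ (x, y)).
  have [k kP] := IH y w' w xy xt w's ws.
  (* Together with the [k] rotations already present these make [m * k], a trivial word. *)
  exists (m.-1 * k)%N.
  apply: (@eqw_trans _ ((w' ++ nseq k true) ++ nseq (m.-1 * k) true)).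
    by apply: eqw_cat; [exact: eqw_sym|exact: eqw_refl].
  rewrite -catA -nseqD -mulSn prednK // -[X in eqw _ _ X]cats0.
  apply: eqw_cat; first exact: eqw_refl.
  by apply: (@eqw_nseq_mod _ _ 0); rewrite modnMr mod0n.
- have xu : path (@adj G) x u by rewrite -(homotopic_path su).1.
  have [v vu] := track_surj xy xu.
  have [k kP] := IH1 y w v xy xs ws vu; have [l lP] := IH2 y v w' xy xu vu w's.
  exists (k + l)%N; rewrite nseqD catA; apply: eqw_trans lP.
  by apply: eqw_cat => //; exact: eqw_refl.
- move: xs; rewrite !cat_path /= => /and3P[xs _ xt].
  have [w1 w1P] := track_surj xy xs.
  set d1 := actG w1 (x, y).
  have d1d : is_dart d1 by exact: (@act_dart _ (x, y)).
  have e1 : last x s = d1.1 by rewrite -w1P (track_last w1 (x, y)).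
  rewrite e1 in xz xt ws.
  have [i iz] := rotG.2 _ _ _ d1d xz.
  have [w2 w2P] := track_surj d1d xt.
  (* Turn [i] times towards [z], cross the edge and return, then turn back: [m.-1 * i] further
     rotations complete [m * i]. *)
  pose u := nseq i true ++ [:: false; false] ++ nseq (m.-1 * i) true.
  have uE : eqw m u [::].
    apply: (@eqw_trans _ (nseq i true ++ nseq (m.-1 * i) true)).
      by apply: eqw_cat; [exact: eqw_refl|apply: (@eqw_cat _ _ [::]); [exact: eqw_flip|exact: eqw_refl]].
    by rewrite -nseqD -mulSn prednK //; apply: (@eqw_nseq_mod _ _ 0); rewrite modnMr mod0n.
  have d1E : (d1.1, d1.2) = d1 by case: d1 {d1d e1 xz xt ws iz w2P}.
  have u1 : actG u d1 = d1.
    rewrite /u !act_cat !act_nseq {1}/act /= /flip /= -!surjective_pairing.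
    rewrite -iterD addnC -mulSn prednK // mulnC.
    by elim: (i) => // c IH; rewrite mulSn iterD IH iter_rotate_m.
  apply: (via y (w1 ++ u ++ w2) (w1 ++ w2)) => //.
  + rewrite ws !track_cat -/d1 u1 w1P -[X in track w2 X]d1E w2P.
    by rewrite !track_nseq act_nseq /= iter_rotate /= iz.
  + by rewrite w's !track_cat -/d1 w1P -[X in track w2 X]d1E w2P.
  + rewrite -[X in eqw _ _ X]/(w1 ++ [::] ++ w2); exact: eqw_ctx.
- have fw d : [seq d.2 | d <- traject (face_step rot) d m] =
      track (flatten (nseq m [:: false; true])) d.
    by elim: (m) d => //= k IH d; congr (_ :: _); exact: IH.
  move: xs; rewrite !cat_path /= => /andP[xs /andP[_ xt]].
  have [w1 w1P] := track_surj xy xs.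
  set d1 := actG w1 (x, y).
  have d1d : is_dart d1 by exact: (@act_dart _ (x, y)).
  have e1 : last x s = d1.1 by rewrite -w1P (track_last w1 (x, y)).
  have xz' := xz; rewrite e1 in xz' ws xt.
  have [i iz] := rotG.2 _ _ _ d1d xz'.
  have lz : last d1.1 (face_walk rot m d1.1 z) = d1.1.
    rewrite /face_walk fw (track_last _ (d1.1, z)) act_face.
    by rewrite -[_ \o _]/(face_step rot) (facesG xz').1.
  rewrite lz in xt; have [w2 w2P] := track_surj d1d xt.
  pose F := flatten (nseq m [:: false; true]).
  pose u := nseq i true ++ F ++ nseq (m.-1 * i) true.
  have uE : eqw m u [::].
    apply: (@eqw_trans _ (nseq i true ++ nseq (m.-1 * i) true)).
      by apply: eqw_cat; [exact: eqw_refl|apply: (@eqw_cat _ _ [::]); [exact: eqw_face|exact: eqw_refl]].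
    by rewrite -nseqD -mulSn prednK //; apply: (@eqw_nseq_mod _ _ 0); rewrite modnMr mod0n.
  have d1E : (d1.1, d1.2) = d1 by case: d1 {d1d e1 xz xz' xt ws iz lz w2P}.
  have iz1 : iter i rotate d1 = (d1.1, z) by rewrite iter_rotate iz.
  have u1 : actG u d1 = d1.
    rewrite /u !act_cat !act_nseq act_face iz1 -[_ \o _]/(face_step rot) (facesG xz').1 -iz1.
    rewrite -iterD addnC -mulSn prednK // mulnC.
    by elim: (i) => // c IH; rewrite mulSn iterD IH iter_rotate_m.
  apply: (via y (w1 ++ u ++ w2) (w1 ++ w2)) => //.
  + rewrite ws !track_cat -/d1 u1 w1P -[X in track w2 X]d1E w2P.
    by rewrite /face_walk fw !track_nseq act_nseq /= iz1 cats0.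
  + by rewrite w's !track_cat -/d1 w1P -[X in track w2 X]d1E w2P.
  + rewrite -[X in eqw _ _ X]/(w1 ++ [::] ++ w2); exact: eqw_ctx.
Qed.

Lemma act_dart_eqw w w' : eqw m w w' -> forall d, is_dart d -> actG w d = actG w' d.
Proof.
elim=> {w w'} [//|w w' _ IH d dd|w2 w1 w3 _ IH1 _ IH2 d dd|x r y rR d dd].
- by rewrite IH.
- by rewrite IH1 ?IH2.
rewrite !act_cat; congr act; have := act_dart x dd; move: (actG x d) => {}d {}dd.
move: rR; rewrite !inE => /or3P[]/eqP->.
- by rewrite act_nseq iter_rotate_m.
- by case: d dd.
- by rewrite act_face -[_ \o _]/(face_step rot); case: d dd => u v; move=> /facesG[].
Qed.

(** A word fixing [d] traces a closed walk, which is contractible. Hence the word followed by some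
    [k] rotations is trivial; these rotations also fix [d], so [m] divides [k]. *)
Lemma act_fix_eqw w d : is_dart d -> actG w d = d -> eqw m w [::].
Proof.
case: d => x y xy wd; have xy' : adj x y := xy.
have ps := @track_path w (x, y) xy.
have ls : last x (track w (x, y)) = x by rewrite (track_last w (x, y)) wd.
have [k kP] := homotopic_eqw (simpG ps ls) xy' ps erefl (erefl : track [::] (x, y) = [::]).
have k0 : k = 0 %[mod m].
  apply: (@iter_rotate_mod (x, y)) => //.
  by have := act_dart_eqw kP xy; rewrite act_cat wd act_nseq.
apply: eqw_trans kP; rewrite -[X in eqw _ X _]cats0.
apply: eqw_cat; first exact: eqw_refl.
exact/eqw_sym/(@eqw_nseq_mod _ _ 0).
Qed.

Lemma iter_rotate_conn d d' : is_dart d -> is_dart d' -> d.1 = d'.1 ->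
  exists k, iter k rotate d = d'.
Proof.
case: d d' => x y [x' y'] /= xy xy' xx'; rewrite -{x'}xx' in xy' *.
by have [k kP] := rotG.2 _ _ _ xy xy'; exists k; rewrite iter_rotate /= kP.
Qed.

Hypothesis connG : forall x y : G, exists s, path (@adj G) x s /\ last x s = y.

Lemma dart_conn d d' : is_dart d -> is_dart d' -> exists w, actG w d = d'.
Proof.
move=> dd dd'; have [s [sp sl]] := connG d.1 d'.1.
have [w wP] : exists w, track w d = s by case: d dd sp {sl} => x y; exact: track_surj.
have e : (actG w d).1 = d'.1 by rewrite -track_last wP.
have [k kP] := iter_rotate_conn (act_dart w dd) dd' e.
by exists (w ++ nseq k true); rewrite act_cat act_nseq.
Qed.

Lemma nbr_exists (x : G) : exists y, adj x y.
Proof.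
apply/set0P/eqP => e; have /card_fset_set := nbrs x.
by rewrite e fset_set0 cardfs0 => m0; move: m_gt0; rewrite -m0.
Qed.

End GraphWords.

Lemma tiling_regular_map (m : nat) (G : graph) : (1 < m)%N -> regular_plane_tiling m G ->
  exists (T : countType) (s a : T -> T) (o : T -> G),
  [/\ regular_map m s a,
      (forall t, o (s t) = o t) /\ (forall t t', o t = o t' -> exists k, iter k s t = t'),
      (forall x, exists t, o t = x),
      (forall t, adj (o t) (o (a t))) /\ (forall x y, adj x y -> exists t, o t = x /\ o (a t) = y) &
      (forall t t', o t = o t' -> o (a t) = o (a t') -> t = t')].
Proof.
move=> m1 [infG connG nbrs [rot [rotG facesG simpG]]].
have [x0 _] : [set: G] !=set0.
  by apply/set0P/eqP => e; apply: infG; rewrite e; exact: finite_set0.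
have [y0 xy0] := nbr_exists m1 nbrs x0.
pose T0 : choiceType := {d : G * G | is_dart d}.
pose d0 : T0 := exist _ (x0, y0) xy0.
pose s0 (d : T0) : T0 := exist _ (rotate rot (val d)) (rotate_dart rotG (valP d)).
pose a0 (d : T0) : T0 := exist _ (flip (val d)) (flip_dart (valP d)).
have act0 w d : val (act s0 a0 w d) = act (rotate rot) (@flip G) w (val d).
  by elim: w d => // -[] w IH d; exact: IH.
have conn0 (d d' : T0) : exists w, act s0 a0 w d = d'.
  have [w wP] := dart_conn rotG connG (valP d) (valP d').
  by exists w; apply/val_inj; rewrite act0.
(* Words from [d0] reach every dart, so darts inject into the countable type of words. *)
pose f (d : T0) := sval (cid (conn0 d0 d)).
have fK : pcancel f (fun w => Some (act s0 a0 w d0)).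
  by move=> d; rewrite (svalP (cid (conn0 d0 d))).
pose T : countType := HB.pack T0 (PCanIsCountable fK).
exists T, s0, a0, (fun d : T0 => (val d).1).
have iters k (d : T0) : val (iter k s0 d) = iter k (rotate rot) (val d).
  by elim: k => // k IH; rewrite !iterS -IH.
split.
- split => //.
  + by move=> [[x y] xy]; apply/val_inj.
  + move=> [[x y] xy]; rewrite -val_eqE /= xpair_eqE; apply/negP => /andP[/eqP/= e _].
    by move: xy; rewrite /is_dart /= e adj_irrefl.
  + by move=> d; apply/val_inj; rewrite iters (iter_rotate_m m1 nbrs rotG (valP d)).
  + by move=> d k km; rewrite -val_eqE iters (iter_rotate_neq m1 nbrs rotG (valP d)).
  + move=> d; rewrite -act_face; apply/val_inj; rewrite act0 act_face.
    by rewrite -[_ \o _]/(face_step rot); move: (valP d); case: (val d) => x y /facesG[].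
  + move=> w d wd; apply: (act_fix_eqw m1 nbrs rotG facesG simpG (valP d)).
    by rewrite -act0 wd.
  + move=> finT; apply: infG.
    have -> : [set: G] = (fun d : T0 => (val d).1) @` [set: T0].
      apply/seteqP; split => // x _; have [y xy] := nbr_exists m1 nbrs x.
      by exists (exist _ (x, y) xy : T0).
    exact: finite_image.
- split => // d d' e; have [k kP] := iter_rotate_conn rotG (valP d) (valP d') e.
  by exists k; apply/val_inj; rewrite iters.
- by move=> x; have [y xy] := nbr_exists m1 nbrs x; exists (exist _ (x, y) xy : T0).
- split; first by move=> d; exact: (valP d).
  by move=> x y xy; exists (exist _ (x, y) xy : T0).
- by move=> [[x y] xy] [[x' y'] xy'] /= e e'; apply/val_inj; rewrite /= e e'.
Qed.

(** * Filling of cycles *)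

Section Fill.
Variables (m : nat) (T : countType) (s a : T -> T).
Hypothesis H : regular_map m s a.

Let m_gt0 : (0 < m)%N. Proof. exact: ltnW (map_m H). Qed.

Lemma map_s_inj : injective s.
Proof.
move=> x y e; rewrite -(map_s_iter H x) -(map_s_iter H y).
by rewrite -(prednK m_gt0) !iterSr e.
Qed.

Lemma map_face_inj : injective (s \o a).
Proof. exact: (inj_comp map_s_inj (inv_inj (map_aK H))). Qed.

Lemma map_a_eq x y : (x == a y) = (a x == y).
Proof. by rewrite (inv_eq (map_aK H)). Qed.

Definition face_closed (A : {fset T}) := forall d, (s (a d) \in A) = (d \in A).

(** The faces of [d] and [a d] are the two sides of an edge, so for a union of faces this is the mod
    2 boundary, recorded on both darts of each edge. *)
Definition bdry (A : {fset T}) (d : T) : bool := (d \in A) (+) (a d \in A).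

Definition is_bdry (c : T -> bool) :=
  exists2 A : {fset T}, face_closed A & c =1 bdry A.

Lemma is_bdry0 (c : T -> bool) : (forall e, c e = false) -> is_bdry c.
Proof. by move=> c0; exists fset0 => // e; rewrite c0 /bdry !inE. Qed.

Lemma is_bdryD (c1 c2 c : T -> bool) : is_bdry c1 -> is_bdry c2 ->
  (forall e, c e = c1 e (+) c2 e) -> is_bdry c.
Proof.
move=> [A fA cA] [B fB cB] cE.
have memE x : (x \in [fset y in A `|` B | (y \in A) (+) (y \in B)]%fset) =
    (x \in A) (+) (x \in B).
  by rewrite !inE /=; case: (x \in A); case: (x \in B).
exists [fset x in A `|` B | (x \in A) (+) (x \in B)]%fset.
  by move=> d; rewrite !memE fA fB.
by move=> e; rewrite cE cA cB /bdry !memE addbACA.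
Qed.

(** The mod 2 edge chain of the walk described by [w] from [d], also recorded on both darts. *)
Fixpoint chain (w : seq bool) (d e : T) : bool :=
  match w with
  | [::] => false
  | true :: w => chain w (s d) e
  | false :: w => (e == d) (+) (e == a d) (+) chain w (a d) e
  end.

Lemma chain_cat u v d e :
  chain (u ++ v) d e = chain u d e (+) chain v (act s a u d) e.
Proof. by elim: u d => //= -[] u IH d; rewrite IH ?addbA. Qed.

Lemma chain_nseq k d e : chain (nseq k true) d e = false.
Proof. by elim: k d => // k IH d; exact: IH. Qed.

Lemma chain_face k d e : chain (flatten (nseq k [:: false; true])) d e =
  (\big[addb/false]_(i < k) (e == iter i (s \o a) d)) (+)
  (\big[addb/false]_(i < k) (a e == iter i (s \o a) d)).
Proof.
elim: k d => [|k IH] d; first by rewrite !big_ord0.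
have recl x : \big[addb/false]_(i < k.+1) (x == iter i (s \o a) d) =
    (x == d) (+) \big[addb/false]_(i < k) (x == iter i (s \o a) (s (a d))).
  by rewrite big_ord_recl; congr (_ (+) _); apply: eq_bigr => i _; rewrite -iterSr.
by rewrite /= !recl IH (map_a_eq e d) addbACA.
Qed.

Lemma chain_face_bdry d : is_bdry (chain (flatten (nseq m [:: false; true])) d).
Proof.
(* Parity of occurrences instead of membership, since [map_face_iter] by itself allows a period
   smaller than [m]. *)
pose F x := \big[addb/false]_(i < m) (x == iter i (s \o a) d).
have FA x : F x -> x \in traject (s \o a) d m.
  move=> Fx; apply/trajectP; apply: contrapT => nx; move: Fx.
  rewrite /F big1 // => i _; apply/negbTE/negP => /eqP e.
  by apply: nx; exists i.
have memE x : (x \in [fset y in traject (s \o a) d m | F y]%fset) = F x.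
  by rewrite !inE /=; case Fx: (F x); rewrite ?andbF // FA.
exists [fset y in traject (s \o a) d m | F y]%fset.
  move=> x; rewrite !memE /F.
  have := @big_ord_recl _ false addb m (fun i => s (a x) == iter i (s \o a) d).
  rewrite big_ord_recr /= (map_face_iter H) addbC => /addbI ->.
  by apply: eq_bigr => i _; rewrite -[s (a x)]/((s \o a) x) -[s (a _)]/((s \o a) _) (inj_eq map_face_inj).
by move=> e; rewrite chain_face /bdry !memE.
Qed.

(** Inserting a relator changes the chain by nothing (rotation), by twice an edge (flip), or by a
    boundary (face). *)
Lemma chain_eqw w w' d : eqw m w w' -> is_bdry (fun e => chain w d e (+) chain w' d e).
Proof.
elim=> {w w'} [w|w w' _|w2 w1 w3 _ IH1 _ IH2|x r y rR].
- by apply: is_bdry0 => e; rewrite addbb.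
- by move=> [A fA cA]; exists A => // e; rewrite addbC cA.
- apply: is_bdryD IH1 IH2 _ => e.
  by rewrite addbA -(addbA (chain w1 d e)) addbb addbF.
have : is_bdry (chain r (act s a x d)).
  move: (act s a x d) => {}d; move: rR; rewrite !inE => /or3P[]/eqP->.
  - by apply: is_bdry0 => e; rewrite chain_nseq.
  - by apply: is_bdry0 => e /=; rewrite (map_aK H) addbF [X in _ (+) X]addbC addbb.
  - exact: chain_face_bdry.
move=> [A fA cA]; exists A => // e; rewrite -cA !chain_cat.
rewrite -act_cat (act_eqw H (w' := x)); last first.
  by rewrite -[X in eqw _ _ X]cats0 -[X in eqw _ X _]cats0 -catA; exact: eqw_relator.
by rewrite addbACA addbb addFb -addbA addbb addbF.
Qed.

Let c0 (d0 d : T) := chain (wordto H d0 d) d0.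

Let c0_s d0 d : is_bdry (fun e => c0 d0 (s d) e (+) c0 d0 d e).
Proof.
have h : eqw m (wordto H d0 (s d)) (wordto H d0 d ++ [:: true]).
  by apply: (act_inj_eqw H (d := d0)); rewrite act_cat !wordtoP.
have [A fA cA] := chain_eqw d0 h; exists A => // e.
by rewrite -cA chain_cat /= addbF.
Qed.

Let c0_a d0 d :
  is_bdry (fun e => c0 d0 (a d) e (+) c0 d0 d e (+) (e == d) (+) (e == a d)).
Proof.
have h : eqw m (wordto H d0 (a d)) (wordto H d0 d ++ [:: false]).
  by apply: (act_inj_eqw H (d := d0)); rewrite act_cat !wordtoP.
have [A fA cA] := chain_eqw d0 h; exists A => // e.
by rewrite -cA chain_cat /= addbF wordtoP !addbA.
Qed.

Let c0_iter d0 d k : is_bdry (fun e => c0 d0 (iter k s d) e (+) c0 d0 d e).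
Proof.
elim: k => [|k IH]; first by apply: is_bdry0 => e; rewrite addbb.
apply: is_bdryD (c0_s d0 (iter k s d)) IH _ => e.
by rewrite iterS addbA -[in RHS](addbA (c0 _ (s _) _)) addbb addbF.
Qed.

Let sum_closed d0 (Z : {fset T}) : (forall d, (a d \in Z) = (d \in Z)) ->
  is_bdry (fun e => (e \in Z) (+) \big[addb/false]_(d <- Z) c0 d0 d e).
Proof.
have [n] := ubnP #|` Z|; elim: n Z => // n IH Z Zn aZ.
have [->|/fset0Pn[d dZ]] := eqVneq Z fset0.
  by apply: is_bdry0 => e; rewrite inE big_seq_fset0.
have adZ : a d \in (Z `\ d)%fset by rewrite !inE aZ dZ (map_a_neq H).
have Zlt : (#|` ((Z `\ d) `\ a d)%fset| < n)%N.
  move: Zn; rewrite (cardfsD1 d Z) dZ (cardfsD1 (a d)) adZ; lia.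
have aZ' x : (a x \in ((Z `\ d) `\ a d)%fset) = (x \in ((Z `\ d) `\ a d)%fset).
  by rewrite !inE aZ (inj_eq (inv_inj (map_aK H))) -map_a_eq andbCA.
apply: is_bdryD (IH _ Zlt aZ') (c0_a d0 d) _ => e.
rewrite (big_fsetD1 d) //= (big_fsetD1 (a d)) //= !inE.
have [->|ned] := eqVneq e d; first rewrite eq_sym (negbTE (map_a_neq H d)) dZ /=.
  by case: (c0 _ _ _); case: (c0 _ _ _); case: (\big[_/_]_(_ <- _) _).
have [->|nead] := eqVneq e (a d); first rewrite aZ dZ /=;
  by case: (c0 _ _ _); case: (c0 _ _ _); case: (\big[_/_]_(_ <- _) _); case: (e \in Z).
Qed.

Definition even_set (Z : {fset T}) :=
  forall d, \big[addb/false]_(i < m) (iter i s d \in Z) = false.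

Lemma orbit_sum_shift (f : T -> bool) x :
  \big[addb/false]_(i < m) f (iter i.+1 s x) = \big[addb/false]_(i < m) f (iter i s x).
Proof.
have := @big_ord_recl _ false addb m (fun i => f (iter i s x)).
by rewrite big_ord_recr /= (map_s_iter H) addbC => /addbI ->.
Qed.

Let sum_even d0 (Z : {fset T}) : even_set Z ->
  is_bdry (fun e => \big[addb/false]_(d <- Z) c0 d0 d e).
Proof.
have [n] := ubnP #|` Z|; elim: n Z => // n IH Z Zn eZ.
have [->|/fset0Pn[d dZ]] := eqVneq Z fset0.
  by apply: is_bdry0 => e; rewrite big_seq_fset0.
have [k km kZ] : exists2 k, (0 < k < m)%N & iter k s d \in Z.
  apply: contrapT => nk; move: (eZ d).
  have <- : m.-1.+1 = m by rewrite prednK.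
  rewrite big_ord_recl /= dZ big1 // => i _.
  apply/negbTE/negP => iZ; apply: nk; exists i.+1 => //.
  by have := ltn_ord i; lia.
have dk := map_s_order H d km.
have kZ' : iter k s d \in (Z `\ d)%fset by rewrite !inE dk kZ.
have Zlt : (#|` ((Z `\ d) `\ iter k s d)%fset| < n)%N.
  move: Zn; rewrite (cardfsD1 d Z) dZ (cardfsD1 (iter k s d)) kZ'; lia.
have eZ' : even_set ((Z `\ d) `\ iter k s d)%fset.
  move=> x; rewrite -[RHS](eZ x).
  (* Each vertex carries both removed darts or neither, so removing them preserves parity. *)
  have e1 : \big[addb/false]_(i < m) (iter i s x == d) =
            \big[addb/false]_(i < m) (iter i s x == iter k s d).
    elim: (k) => // l ->; rewrite -(orbit_sum_shift (pred1 (iter l.+1 s d))).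
    by apply: eq_bigr => i _; rewrite /= (inj_eq map_s_inj).
  transitivity (\big[addb/false]_(i < m) (((iter i s x \in Z) (+)
      (iter i s x == d)) (+) (iter i s x == iter k s d))).
    apply: eq_bigr => i _; rewrite !inE.
    case: (eqVneq (iter i s x) d) => [->|_].
      by rewrite eq_sym (negbTE dk) dZ.
    by case: (eqVneq (iter i s x) (iter k s d)) => [->|_]; rewrite ?kZ //= !addbF.
  by rewrite !big_split /= e1 -addbA addbb addbF.
apply: is_bdryD (IH _ Zlt eZ') (c0_iter d0 d k) _ => e.
rewrite (big_fsetD1 d) //= (big_fsetD1 (iter k s d)) //=.
by rewrite addbA addbC; congr (_ (+) _); rewrite addbC.
Qed.

(* Modulo boundaries, [Z] is the sum over its darts [d] of the chains of the
   words from a base dart to [d], because the closed walk through an edge of [Z]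
   and these two words is a boundary; at each vertex these chains agree modulo
   boundaries and occur an even number of times. *)
Lemma even_set_bdry (Z : {fset T}) : (forall d, (a d \in Z) = (d \in Z)) ->
  even_set Z -> is_bdry (fun e => e \in Z).
Proof.
move=> aZ eZ.
have [->|/fset0Pn[d0 _]] := eqVneq Z fset0; first by apply: is_bdry0 => e; rewrite inE.
apply: is_bdryD (sum_closed d0 aZ) (sum_even d0 eZ) _ => e.
by rewrite -addbA addbb addbF.
Qed.

End Fill.

(** * Clusters *)

(* Exactness of [0 -> F^A -> F^B -> F^C -> F -> 0], the last map being the sum of the coordinates. *)
Lemma exact_card (F : fieldType) (A B C : finType) (N : A -> B -> F) (M : B -> C -> F) :
  (forall u : A -> F, (forall b, \sum_x u x * N x b = 0) -> forall x, u x = 0) ->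
  (forall x c, \sum_b N x b * M b c = 0) ->
  (forall z : B -> F, (forall c, \sum_b z b * M b c = 0) ->
     exists u : A -> F, forall b, z b = \sum_x u x * N x b) ->
  (forall b, \sum_c M b c = 0) ->
  (forall u : C -> F, (forall b, \sum_c M b c * u c = 0) -> forall x y, u x = u y) ->
  (0 < #|C|)%N -> (#|A| + #|C| = #|B| + 1)%N.
Proof.
move=> injN NM imN M1 kerM C0.
pose N' := \matrix_(i < #|A|, j < #|B|) N (enum_val i) (enum_val j).
pose M' := \matrix_(i < #|B|, j < #|C|) M (enum_val i) (enum_val j).
have sumv (I : finType) (f : I -> F) : \sum_(i < #|I|) f (enum_val i) = \sum_x f x.
  by rewrite [RHS](reindex_onto enum_val enum_rank) //=;
    [apply: eq_bigl => i; rewrite enum_valK eqxx|move=> i _; rewrite enum_rankK].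
have rN : \rank N' = #|A|.
  apply/eqP; rewrite -[_ == _]/(row_free N') -kermx_eq0; apply/rowV0P => v /sub_kermxP vN.
  apply/rowP => i; rewrite mxE.
  have := injN (fun x => v 0 (enum_rank x)); move=> /(_ _ (enum_val i)); rewrite enum_valK; apply => b.
  have /rowP/(_ (enum_rank b)) := vN; rewrite !mxE => h; apply: etrans h.
  by rewrite -[LHS]sumv; apply: eq_bigr => j _; rewrite !mxE enum_valK enum_rankK.
have kM : (kermx M' :=: N')%MS.
  apply/eqmxP/andP; split; last first.
    apply/sub_kermxP/matrixP => i j; rewrite !mxE; apply: etrans (NM (enum_val i) (enum_val j)); rewrite -[RHS]sumv.
    by apply: eq_bigr => k _; rewrite !mxE.
  apply/rV_subP => z /sub_kermxP zM.
  have [|u uP] := imN (fun b => z 0 (enum_rank b)).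
    move=> c; have /rowP/(_ (enum_rank c)) := zM; rewrite !mxE => h; apply: etrans h.
    by rewrite -[LHS]sumv; apply: eq_bigr => j _; rewrite !mxE enum_valK enum_rankK.
  apply/submxP; exists (\row_i u (enum_val i)); apply/rowP => j; rewrite !mxE.
  have := uP (enum_val j); rewrite enum_valK => ->.
  by rewrite -[LHS]sumv; apply: eq_bigr => i _; rewrite !mxE.
(* Functions on [C] killed by [M] are constant, so [M'] has rank [#|C|] - 1; its kernel has
   dimension [#|A|], and rank-nullity gives the count. *)
have kMt : (kermx M'^T :=: (const_mx 1 : 'rV[F]_#|C|))%MS.
  apply/eqmxP/andP; split; last first.
    apply/sub_kermxP/rowP => j; rewrite !mxE; apply: etrans (M1 (enum_val j)); rewrite -[RHS]sumv.
    by apply: eq_bigr => k _; rewrite !mxE mul1r.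
  apply/rV_subP => z /sub_kermxP zM.
  have eqz : forall x y, z 0 (enum_rank x) = z 0 (enum_rank y).
    apply: (kerM (fun c => z 0 (enum_rank c))) => b.
    have /rowP/(_ (enum_rank b)) := zM; rewrite !mxE => h; apply: etrans h.
    by rewrite -[LHS]sumv; apply: eq_bigr => j _; rewrite !mxE enum_valK enum_rankK mulrC.
  apply/submxP; exists (const_mx (z 0 (Ordinal C0))); apply/rowP => j.
  rewrite !mxE big_ord1 !mxE mulr1.
  by rewrite -(enum_valK j) -(enum_valK (Ordinal C0)).
have := mxrank_ker M'; have := mxrank_ker M'^T; rewrite mxrank_tr kM kMt rN.
have -> : \rank (const_mx 1 : 'rV[F]_#|C|) = 1%N.
  by rewrite rank_rV; case: eqP => // /rowP/(_ (Ordinal C0))/eqP; rewrite !mxE oner_eq0.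
have := rank_leq_row M'; have := rank_leq_col M'; lia.
Qed.

Section Clusters.
Variables (T : choiceType) (f a : T -> T).

(** A dart stands for its whole vertex, the orbit of [f]. No inverse step of [f] is included,
    because [f] will have finite order; see [conn_sym]. *)
Inductive conn (o : T -> bool) (x : T) : T -> Prop :=
| conn_refl : conn o x x
| conn_rot y : conn o x y -> conn o x (f y)
| conn_flip y : conn o x y -> o y -> conn o x (a y).

Lemma conn_trans o y x z : conn o x y -> conn o y z -> conn o x z.
Proof.
by move=> xy; elim=> [//|u _ IH|u _ IH ou]; [exact: conn_rot|exact: conn_flip].
Qed.

Lemma conn_iter o k x : conn o x (iter k f x).
Proof. by elim: k => [|k IH]; [exact: conn_refl|exact: conn_rot]. Qed.

Lemma conn_sub (o o' : T -> bool) x y :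
  (forall z, conn o x z -> o z -> o' z) -> conn o x y -> conn o' x y.
Proof.
move=> oo'; elim=> [|u _ IH|u xu IH ou]; first exact: conn_refl.
- exact: conn_rot.
- by apply: conn_flip => //; exact: oo'.
Qed.

(* A finite subgraph is encoded by the set [C.1] of the darts at its vertices and
   the set [C.2] of the darts on its edges, where vertices are the orbits of [f];
   taking the face permutation for [f] gives the finite subgraphs of the dual. *)
Definition animal (C : {fset T} * {fset T}) : Prop :=
  [/\ exists d, d \in C.1,
      forall x, (f x \in C.1) = (x \in C.1),
      {subset C.2 <= C.1},
      forall x, (a x \in C.2) = (x \in C.2) &
      forall x y, x \in C.1 -> y \in C.1 -> conn (fun z => z \in C.2) x y].

(** For an animal this says that [C] is a whole cluster of [o]: no edge at its vertices outside
    [C.2] satisfies [o]. *)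
Definition fits (o : T -> bool) (C : {fset T} * {fset T}) : Prop :=
  forall x, x \in C.1 -> o x = (x \in C.2).

Definition cluster (o : T -> bool) (x : T) : {fset T} * {fset T} :=
  (fset_set [set y | conn o x y], fset_set [set y | conn o x y /\ o y]).

Section Fits.
Variables (m : nat) (o : T -> bool).
Hypothesis m_gt0 : (0 < m)%N.
Hypothesis fm : forall x, iter m f x = x.
Hypothesis aK : involutive a.
Hypothesis oa : forall x, o (a x) = o x.

Lemma conn_sym x y : conn o x y -> conn o y x.
Proof.
elim=> [|u xu IH|u xu IH ou]; first exact: conn_refl.
- apply: conn_trans IH; rewrite -[X in conn _ _ X]fm -(prednK m_gt0) iterSr.
  exact: conn_iter.
- by apply: conn_trans IH; rewrite -[X in conn _ _ X]aK; apply: conn_flip; [exact: conn_refl|rewrite oa].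
Qed.

Lemma animal_conn C x y : animal C -> fits o C -> x \in C.1 ->
  (y \in C.1) <-> conn o x y.
Proof.
move=> [_ fC sC aC cC] oC xC; split => [yC|].
  have : conn (fun z => z \in C.2) x y by exact: cC.
  by apply: conn_sub => z _ zC; rewrite oC //; exact: sC.
elim=> [//|u _ uC|u _ uC ou]; first by rewrite fC.
by apply: sC; rewrite aC -oC.
Qed.

Lemma animal_cluster C x : animal C -> fits o C -> x \in C.1 -> C = cluster o x.
Proof.
move=> Ca oC xC; have cE y := animal_conn y Ca oC xC.
have fin : finite_set [set y | conn o x y].
  by apply: sub_finite_set (finite_fset C.1) => y /= /cE.
have fin2 : finite_set [set y | conn o x y /\ o y] by apply: sub_finite_set fin => y [].
case: C Ca oC xC cE {fin} => V E [_ _ /= sC _ _] oC _ cE; congr (_, _); apply/fsetP => y.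
- rewrite in_fset_set; last by apply: sub_finite_set (finite_fset V) => z /= /cE.
  by apply/idP/idP; rewrite inE; [exact: (cE y).1|exact: (cE y).2].
- rewrite in_fset_set //; apply/idP/idP => [yE|]; rewrite inE /=.
    by split; [apply/cE/sC|rewrite oC //; exact: sC].
  by move=> [/cE yV oy]; rewrite -oC.
Qed.

Lemma cluster_animal x : finite_set [set y | conn o x y] ->
  [/\ animal (cluster o x), fits o (cluster o x),
      forall y, (y \in (cluster o x).1) = `[< conn o x y >] &
      forall y, (y \in (cluster o x).2) = `[< conn o x y >] && o y].
Proof.
move=> fin; have fin2 : finite_set [set y | conn o x y /\ o y] by apply: sub_finite_set fin => y [].
have mem1 y : (y \in (cluster o x).1) = `[< conn o x y >].
  by rewrite in_fset_set //; apply/idP/asboolP; rewrite inE.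
have mem2 y : (y \in (cluster o x).2) = `[< conn o x y >] && o y.
  rewrite in_fset_set //; apply/idP/andP; rewrite inE /=.
    by move=> [? ?]; split => //; exact/asboolP.
  by move=> [/asboolP].
split => //; last by move=> y; rewrite mem1 mem2 => ->.
split.
- by exists x; rewrite mem1; apply/asboolP; exact: conn_refl.
- move=> y; rewrite !mem1; apply/asboolP/asboolP; last exact: conn_rot.
  move=> xfy; apply: conn_trans xfy _; apply: conn_sym.
  exact/conn_rot/conn_refl.
- by move=> y; rewrite mem1 mem2 => /andP[].
- move=> y; rewrite !mem2 oa; case oy: (o y); rewrite ?andbF // !andbT.
  apply/asboolP/asboolP => xy; last exact: conn_flip.
  by rewrite -[y]aK; apply: conn_flip; rewrite ?oa.
- move=> y z; rewrite !mem1 => /asboolP xy /asboolP xz.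
  have : conn o y z by exact: conn_trans (conn_sym xy) xz.
  apply: conn_sub => u yu ou; rewrite mem2 ou andbT; apply/asboolP.
  exact: conn_trans yu.
Qed.

End Fits.
End Clusters.

(** * Outer boundaries of dual clusters *)

Section Planarity.
Variables (m : nat) (T : countType) (s a : T -> T).
Hypothesis H : regular_map m s a.

Local Notation face := (s \o a).

Let m_gt0 : (0 < m)%N. Proof. exact: ltnW (map_m H). Qed.
Let aK := map_aK H.

(* [surrounds K L] says that [K] carries the outer boundary of the dual cluster
   [L]: the part of the boundary of [L] in [K] bounds a finite set of faces
   that contains [L]. *)
Definition surrounds (K L : {fset T} * {fset T}) : Prop :=
  exists A : {fset T}, [/\ face_closed s a A,
    (forall e, bdry a A e = bdry a L.1 e && (e \in K.2)) & {subset L.1 <= A}].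

Lemma bdry_flip (A : {fset T}) e : bdry a A (a e) = bdry a A e.
Proof. by rewrite /bdry aK addbC. Qed.

(** Without such an edge, [A] would be closed under [a] and [s], hence contain all darts by
    connectedness, and these are infinitely many. *)
Lemma bdry_nonempty (A : {fset T}) d : face_closed s a A -> d \in A ->
  exists e, e \in A /\ a e \notin A.
Proof.
move=> fA dA; apply: contrapT => ne.
have aA x : x \in A -> a x \in A.
  by move=> xA; apply: contrapT => /negP ax; apply: ne; exists x.
have sA x : x \in A -> s x \in A.
  by move=> /aA; rewrite -fA aK.
apply: (map_infinite H); apply: sub_finite_set (finite_fset A) => x _ /=.
have [w <-] := map_conn H d x.
by elim: w d dA => //= -[] w IH d dA; apply: IH; [exact: sA|exact: aA].
Qed.

Variable o : T -> bool.
Hypothesis oa : forall x, o (a x) = o x.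
Hypothesis fin_o : forall x, finite_set [set y | conn s a o x y].

Local Notation co := (fun x => ~~ o x).

Let coa x : co (a x) = co x. Proof. by rewrite /= oa. Qed.

Let clP x := cluster_animal m_gt0 (map_s_iter H) aK oa (fin_o x).

Lemma dual_closed L : animal face a L -> face_closed s a L.1.
Proof. by case. Qed.

(** Crossing a closed edge never leaves a dual cluster. *)
Lemma dual_bdry_open L e : animal face a L -> fits co L -> bdry a L.1 e -> o e.
Proof.
move=> [_ _ sL aL _] cL.
have main x : x \in L.1 -> a x \notin L.1 -> o x.
  move=> xL; apply: contraNT => nx; apply: sL; rewrite aL.
  by rewrite -cL.
rewrite /bdry; case: (boolP (e \in L.1)) => eL /= aeL; first exact: main.
by rewrite -oa main // aK.
Qed.

(** Paths in [L] cross closed edges only, and the boundary of [A] consists of open edges. *)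
Lemma dual_in_or_out L A x y : animal face a L -> fits co L -> face_closed s a A ->
  (forall e, bdry a A e -> o e) -> x \in L.1 -> y \in L.1 -> x \in A -> y \in A.
Proof.
move=> [_ _ sL _ cL] fL fA bA xL yL xA.
elim: (cL x y xL yL) => [//|u _ uA|u _ uA uL]; first by rewrite /= fA.
apply: contraT => ua; have := bA u; rewrite /bdry uA (negbTE ua) /= => /(_ isT) ou.
by have := fL u (sL _ uL); rewrite uL ou.
Qed.

(** All darts at a vertex lie in one primal cluster, so the part of the boundary of [L] in the
    cluster of [d] is still even at every vertex. It is finite with that cluster, hence can be
    filled. *)
Lemma fill_part L d : animal face a L -> fits co L -> exists A : {fset T},
  face_closed s a A /\ forall e, bdry a A e = bdry a L.1 e && `[< conn s a o d e >].
Proof.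
move=> aL fL.
have fin : finite_set [set e | bdry a L.1 e /\ conn s a o d e].
  by apply: sub_finite_set (fin_o d) => e [].
pose Z := fset_set [set e | bdry a L.1 e /\ conn s a o d e].
have ZE e : (e \in Z) = bdry a L.1 e && `[< conn s a o d e >].
  rewrite in_fset_set //; apply/idP/andP; rewrite inE /=.
    by move=> [? ?]; split => //; exact/asboolP.
  by move=> [? /asboolP].
have aZ e : (a e \in Z) = (e \in Z).
  rewrite !ZE bdry_flip; case be: (bdry a L.1 e) => //=.
  have oe := dual_bdry_open aL fL be.
  apply/asboolP/asboolP => de; last exact: conn_flip.
  by rewrite -[e]aK; apply: conn_flip; rewrite ?oa.
have eZ : even_set m s Z.
  move=> x; have [dx|ndx] := pselect (conn s a o d x); last first.
    rewrite big1 // => i _; rewrite ZE; apply/negbTE; rewrite negb_and; apply/orP; right.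
    apply/asboolPn => dix; apply: ndx; apply: conn_trans dix _.
    by apply: (conn_sym m_gt0 (map_s_iter H) aK oa); exact: conn_iter.
  (* The darts [a y] and [s y] are on the same face, so boundary membership of [y] compares two
     consecutive darts around the vertex, and the cyclic sum telescopes. *)
  rewrite (eq_bigr (fun i : 'I_m => (iter i s x \in L.1) (+) (iter i.+1 s x \in L.1))).
    rewrite big_split /= (orbit_sum_shift H (fun y => y \in L.1)) addbb //.
  move=> i _; rewrite ZE /bdry.
  have -> : `[< conn s a o d (iter i s x) >] by apply/asboolP; exact: conn_trans dx (conn_iter _ _ _ _ _).
  by rewrite andbT iterS -(dual_closed aL (a (iter i s x))) aK.
have [A fA AZ] := even_set_bdry H aZ eZ.
by exists A; split => // e; rewrite -AZ ZE.
Qed.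

(* Otherwise [L] together with the finite fillings of the parts of its boundary
   in the various clusters would be a finite set of faces without boundary. *)
Lemma surrounds_exists L : animal face a L -> fits co L ->
  exists2 d, surrounds (cluster s a o d) L & d \in L.1.
Proof.
move=> aL fL; have [A AP] := choice (fun d => fill_part d aL fL).
have bA d e : bdry a (A d) e -> o e.
  by rewrite (AP d).2 => /andP[+ _]; exact: dual_bdry_open.
apply: contrapT => ns.
(* A filling that meets [L] contains [L] and would make its cluster surround [L]; so every filling
   misses [L]. *)
have disj d x : d \in L.1 -> x \in L.1 -> x \notin A d.
  move=> dL xL; apply/negP => xA; apply: ns; exists d => //; exists (A d); split.
  - exact: (AP d).1.
  - move=> e; rewrite (AP d).2; have [_ _ _ ->] := clP d.
    by case be: (bdry a L.1 e); rewrite //= (dual_bdry_open aL fL be) andbT.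
  - by move=> y yL; exact: (dual_in_or_out aL fL (AP d).1 (@bA d) xL yL xA).
pose X := (L.1 `|` \bigcup_(d <- L.1) A d)%fset.
have XP x : reflect (x \in L.1 \/ exists2 d, d \in L.1 & x \in A d) (x \in X).
  rewrite inE; apply: (iffP orP) => -[xL|xA]; [by left| |by left|]; right.
    by move/bigfcupP : xA => [d /andP[dL _] xA]; exists d.
  by case: xA => d dL xA; apply/bigfcupP; exists d => //; rewrite dL.
have fX : face_closed s a X.
  move=> x; apply/XP/XP => -[xL|[d dL xA]].
  - by left; rewrite -(dual_closed aL).
  - by right; exists d => //; rewrite -(AP d).1.
  - by left; rewrite (dual_closed aL).
  - by right; exists d => //; rewrite (AP d).1.
have [[d dL] _ _ _ _] := aL.
have [|e [eX /XP aeX]] := bdry_nonempty (d := d) fX; first by apply/XP; left.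
(* An edge leaving [L] bounds the filling [A e], which must then contain the other side. An edge
   leaving a filling bounds [L], so its other side is in [L]. Neither edge leaves [X]. *)
case/XP: eX => [eL|[d' d'L eA]].
- have aeL : a e \notin L.1 by apply/negP => h; apply: aeX; left.
  have be : bdry a L.1 e by rewrite /bdry eL.
  have : bdry a (A e) e by rewrite (AP e).2 be /=; apply/asboolP; exact: conn_refl.
  rewrite /bdry (negbTE (disj e e eL eL)) /= => aeA.
  by apply: aeX; right; exists e.
- have aeA : a e \notin A d' by apply/negP => h; apply: aeX; right; exists d'.
  have : bdry a (A d') e by rewrite /bdry eA.
  rewrite (AP d').2 => /andP[+ _]; rewrite /bdry.
  have /negbTE -> /= : e \notin L.1 by apply/negP => eL; move: (disj d' e d'L eL); rewrite eA.
  by move=> h; apply: aeX; left.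
Qed.

(* The edge leaving the union of the two fillings lies in both boundaries. *)
Lemma surrounds_meet K K' L : surrounds K L -> surrounds K' L -> L.1 != fset0 ->
  exists e, e \in K.2 /\ e \in K'.2.
Proof.
move=> [A [fA bA LA]] [A' [fA' bA' LA']] /fset0Pn[d dL].
have fX : face_closed s a (A `|` A')%fset by move=> x; rewrite !inE fA fA'.
have [|e [eX aeX]] := bdry_nonempty (d := d) fX; first by rewrite inE LA.
exists e; move: aeX; rewrite inE negb_or => /andP[aeA aeA'].
have aeL : a e \notin L.1 by apply: contra aeA; exact: LA.
suff eL : e \in L.1.
  have := bA e; have := bA' e; rewrite /bdry (LA _ eL) (LA' _ eL) (negbTE aeA) (negbTE aeA') /=.
  by move=> /esym/andP[_ ?] /esym/andP[_ ?].
move: eX; rewrite inE => /orP[eA|eA'].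
- by have := bA e; rewrite /bdry eA (negbTE aeA) (negbTE aeL) !addbF => /esym/andP[].
- by have := bA' e; rewrite /bdry eA' (negbTE aeA') (negbTE aeL) !addbF => /esym/andP[].
Qed.

Lemma surrounds_unique L : animal face a L -> fits co L ->
  exists K, forall K', (animal s a K' /\ fits o K' /\ surrounds K' L) <-> K' = K.
Proof.
move=> aL fL; have [d dL _] := surrounds_exists aL fL.
have [L0 _ _ _ _] := aL.
have Ln : L.1 != fset0 by apply/fset0Pn.
have [aK' fK' _ _] := clP d.
exists (cluster s a o d) => K'; split => [[aK1 [fK1 sK1]]|->]; last by [].
have [e [eK eK']] := surrounds_meet sK1 dL Ln.
have e1 : e \in K'.1 by case: aK1 => _ _ sK _ _; exact: sK.
have e2 : e \in (cluster s a o d).1 by case: aK' => _ _ sK _ _; exact: sK.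
rewrite (animal_cluster aK1 fK1 e1).
by rewrite [RHS](animal_cluster aK' fK' e2).
Qed.

End Planarity.

Lemma exact_card_fset (F : fieldType) (A B C : choiceType)
    (S : {fset A}) (Y : {fset B}) (X : {fset C}) (N : A -> B -> F) (M : B -> C -> F) :
  (forall u : A -> F, {in Y, forall b, \sum_(x <- S) u x * N x b = 0} ->
     {in S, forall x, u x = 0}) ->
  {in S & X, forall x c, \sum_(b <- Y) N x b * M b c = 0} ->
  (forall z : B -> F, {in X, forall c, \sum_(b <- Y) z b * M b c = 0} ->
     exists u : A -> F, {in Y, forall b, z b = \sum_(x <- S) u x * N x b}) ->
  {in Y, forall b, \sum_(c <- X) M b c = 0} ->
  (forall u : C -> F, {in Y, forall b, \sum_(c <- X) M b c * u c = 0} ->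
     {in X &, forall x y, u x = u y}) ->
  X != fset0 -> (#|` S| + #|` X| = #|` Y| + 1)%N.
Proof.
move=> injN NM imN M1 kerM X0; rewrite !cardfE.
have ext (I : choiceType) (Z : {fset I}) (u : Z -> F) x : oapp u 0 (insub (val x)) = u x.
  by rewrite valK.
apply: (@exact_card F S Y X (fun x b => N (val x) (val b)) (fun b c => M (val b) (val c))).
- move=> u uN x; rewrite -ext; apply: (injN (fun y => oapp u 0 (insub y)) _ _ (valP x)) => b bY.
  rewrite big_seq_fsetE -[RHS](uN [` bY]%fset).
  by apply: eq_bigr => y _; rewrite ext.
- by move=> x c; rewrite -[RHS](NM _ _ (valP x) (valP c)) [in RHS]big_seq_fsetE.
- move=> z zM; have [|u uP] := imN (fun b => oapp z 0 (insub b)).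
    move=> c cX; rewrite big_seq_fsetE -[RHS](zM [` cX]%fset).
    by apply: eq_bigr => y _; rewrite ext.
  exists (fun x => u (val x)) => b; rewrite -(ext _ _ z b) uP ?(valP b) //.
  by rewrite big_seq_fsetE.
- by move=> b; rewrite -[RHS](M1 _ (valP b)) [in RHS]big_seq_fsetE.
- move=> u uM x y; rewrite -(ext _ _ u x) -(ext _ _ u y).
  apply: (kerM (fun c => oapp u 0 (insub c)) _ _ _ (valP x) (valP y)) => b bY.
  rewrite big_seq_fsetE -[RHS](uM [` bY]%fset).
  by apply: eq_bigr => z _; rewrite ext.
- by rewrite -cardfE cardfs_gt0.
Qed.

(** * Sums over vertices and edges by orbit representatives *)

Section Representatives.
Variables (m : nat) (T : countType) (s a : T -> T).
Hypothesis H : regular_map m s a.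

Let m_gt0 : (0 < m)%N. Proof. exact: ltnW (map_m H). Qed.
Let aK := map_aK H.

Definition vertex_rep (x : T) : T := choose (fun y => y \in traject s x m) x.

Lemma orbit_refl x : x \in traject s x m.
Proof. by apply/trajectP; exists 0%N. Qed.

Lemma orbit_s x : traject s (s x) m =i traject s x m.
Proof.
move=> y; apply/trajectP/trajectP => -[i im ->].
  rewrite -iterSr; have [e|ne] := eqVneq i.+1 m; last by exists i.+1 => //; lia.
  by exists 0%N => //; rewrite e (map_s_iter H).
case: i im => [|i] im; last by exists i; [lia|rewrite -iterSr].
by exists m.-1; [lia|rewrite -iterSr prednK // (map_s_iter H)].
Qed.

Lemma vertex_rep_s x : vertex_rep (s x) = vertex_rep x.
Proof.
rewrite /vertex_rep (eq_choose (Q := fun y => y \in traject s x m)); last exact: orbit_s.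
by apply: choose_id; [rewrite -orbit_s|]; exact: orbit_refl.
Qed.

Lemma vertex_rep_iter k x : vertex_rep (iter k s x) = vertex_rep x.
Proof. by elim: k => // k IH; rewrite iterS vertex_rep_s. Qed.

Lemma vertex_repP x : exists2 k, (k < m)%N & vertex_rep x = iter k s x.
Proof.
have /trajectP[k km e] := @chooseP _ (fun y => y \in traject s x m) x (orbit_refl x).
by exists k.
Qed.

Lemma vertex_repK x : vertex_rep (vertex_rep x) = vertex_rep x.
Proof. by have [k _ {1}->] := vertex_repP x; rewrite vertex_rep_iter. Qed.

Lemma vertex_rep_eq x y : vertex_rep x = vertex_rep y -> exists k, iter k s x = y.
Proof.
have [k km ->] := vertex_repP x; have [l lm ->] := vertex_repP y => e.
by exists (m - l + k)%N; rewrite iterD e -iterD subnK ?(map_s_iter H) // ltnW.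
Qed.

Lemma iter_s_inj x i j : (i < m)%N -> (j < m)%N -> iter i s x = iter j s x -> i = j.
Proof.
wlog ij : i j / (i <= j)%N.
  by move=> wl im jm e; case: (leqP i j) => [|/ltnW] h; [|symmetry]; apply: wl.
move=> im jm; rewrite -(subnKC ij) iterD.
have itI : injective (iter i s) by elim: (i) => // n IH y z /= /(map_s_inj H)/IH.
move=> /itI e; apply/eqP; rewrite eqn_leq leq_addr /= subnKC // leqNgt; apply/negP => lt.
have := map_s_order H x (k := (j - i)%N); rewrite -e eqxx.
by move=> /(_ ltac:(lia)).
Qed.

Definition vertex_reps (V : {fset T}) : {fset T} := [fset x in V | vertex_rep x == x]%fset.

(** Selects one dart per edge: [a] has no fixed point, so the two codes differ. *)
Definition edge_reps (E : {fset T}) : {fset T} :=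
  [fset x in E | (choice.pickle x < choice.pickle (a x))%N]%fset.

Lemma big_vertex_reps (R : Type) (idx : R) (op : Monoid.com_law idx) (V : {fset T}) (F : T -> R) :
  (forall x, (s x \in V) = (x \in V)) ->
  \big[op/idx]_(x <- V) F x =
  \big[op/idx]_(x <- vertex_reps V) \big[op/idx]_(i < m) F (iter i s x).
Proof.
move=> sV.
have itV k x : (iter k s x \in V) = (x \in V) by elim: k => // k IH; rewrite iterS sV.
transitivity (\big[op/idx]_(y <- [seq iter i s x | x <- vertex_reps V, i <- iota 0 m]) F y).
  apply/perm_big/uniq_perm => //.
    apply: allpairs_uniq; [exact: fset_uniq|exact: iota_uniq|].
    move=> [x i] [y j] /allpairsP[[x' i'] [/= xV im [-> ->]]].
    move=> /allpairsP[[y' j'] [/= yV jm [-> ->]]] e.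
    move: xV yV im jm; rewrite !inE /= !mem_iota !add0n => /andP[_ /eqP xr] /andP[_ /eqP yr] im jm.
    have xy : x' = y' by rewrite -xr -yr -(vertex_rep_iter i' x') e vertex_rep_iter.
    by move: e; rewrite xy => /iter_s_inj ->.
  move=> y; apply/idP/allpairsP => [yV|[[x i] [/= xV _ ->]]]; last first.
    by move: xV; rewrite !inE /= itV => /andP[].
  have [k km e] := vertex_repP y.
  have [l le] : exists2 l, (l < m)%N & iter l s (vertex_rep y) = y.
    exists (if k == 0 then 0 else m - k)%N; first by case: ifP => // /negbT; lia.
    case: ifP => [/eqP k0|k0]; first by rewrite e k0.
    by rewrite e -iterD subnK ?(map_s_iter H) // ltnW.
  move=> ly; exists (vertex_rep y, l); rewrite mem_iota /= ly; split => //.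
  by rewrite !inE /= vertex_repK eqxx andbT e itV.
rewrite big_allpairs_dep; apply: eq_bigr => x _.
have -> : iota 0 m = index_iota 0 m by rewrite /index_iota subn0.
by rewrite big_mkord.
Qed.

Lemma big_edge_reps (R : Type) (idx : R) (op : Monoid.com_law idx) (E : {fset T}) (F : T -> R) :
  (forall x, (a x \in E) = (x \in E)) ->
  \big[op/idx]_(x <- E) F x =
  \big[op/idx]_(x <- edge_reps E) op (F x) (F (a x)).
Proof.
move=> aE.
have pne x : choice.pickle x != choice.pickle (a x).
  by rewrite (inj_eq (pcan_inj (@choice.pickleK T))) eq_sym (map_a_neq H).
transitivity (\big[op/idx]_(y <- edge_reps E ++ map a (edge_reps E)) F y); last first.
  by rewrite big_cat big_map big_split.
apply/perm_big/uniq_perm => //.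
  rewrite cat_uniq map_inj_uniq ?fset_uniq ?andbT //=; last exact: inv_inj.
  apply/hasPn => _ /mapP[x xE ->]; move: xE; rewrite !inE /= aK => /andP[_ lt].
  by rewrite negb_and -leqNgt (ltnW lt) orbT.
move=> y; rewrite mem_cat; apply/idP/orP => [yE|[|/mapP[x xE ->]]].
- case: (ltngtP (choice.pickle y) (choice.pickle (a y))) => [lt|gt|/eqP]; last by rewrite (negbTE (pne y)).
    by left; rewrite !inE /= yE.
  by right; apply/mapP; exists (a y); rewrite ?aK // !inE /= aE yE aK.
- by rewrite !inE /= => /andP[].
- by move: xE; rewrite !inE /= aE => /andP[].
Qed.

Lemma card_vertex_reps (V : {fset T}) : (forall x, (s x \in V) = (x \in V)) ->
  #|` V| = (m * #|` vertex_reps V|)%N.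
Proof.
move=> sV; have := @big_vertex_reps _ 0%N addn V (fun=> 1%N) sV.
rewrite big_const_seq count_predT iter_addn_0 mul1n => ->.
under eq_bigr do rewrite sum1_card card_ord.
by rewrite big_const_seq count_predT iter_addn_0.
Qed.

Lemma card_edge_reps (E : {fset T}) : (forall x, (a x \in E) = (x \in E)) ->
  #|` E| = (2 * #|` edge_reps E|)%N.
Proof.
move=> aE; have := @big_edge_reps _ 0%N addn E (fun=> 1%N) aE.
by rewrite !big_const_seq !count_predT !iter_addn_0 mul1n => ->.
Qed.

End Representatives.

(** * Euler's formula for finite open clusters *)

Section Euler.
Variables (m : nat) (T : countType) (s a : T -> T).
Hypothesis H : regular_map m s a.

Local Notation face := (s \o a).

Let m_gt0 : (0 < m)%N. Proof. exact: ltnW (map_m H). Qed.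
Let aK := map_aK H.

Variable o : T -> bool.
Hypothesis oa : forall x, o (a x) = o x.
Hypothesis fin_o : forall x, finite_set [set y | conn s a o x y].

Local Notation co := (fun x => ~~ o x).

Let coa x : co (a x) = co x. Proof. by rewrite /= oa. Qed.

Let clP x := cluster_animal m_gt0 (map_s_iter H) aK oa (fin_o x).

(* If another cluster [K'] carried the outer boundary of [L], then [K], being
   connected and disjoint from [K'], would lie inside the filling [M] of that
   boundary, and no edge could leave the union of [A] and [M]. *)
Lemma surrounds_inside K A L e : animal s a K -> fits o K ->
  face_closed s a A -> (forall x, bdry a A x -> x \in K.2) ->
  animal face a L -> fits co L -> {subset L.1 <= A} ->
  e \in L.1 -> e \in K.2 -> surrounds s a K L.
Proof.
move=> aniK fK fA bA aniL fL LA eL eK.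
have [d [M [fM bM LM]] dL] := surrounds_exists H oa fin_o aniL fL.
have [aniK' fK' _ _] := clP d; set K' := cluster s a o d in aniK' fK' bM.
have [_ sK subK aK2 cK] := aniK; have [_ _ subK' _ _] := aniK'.
have [[x [xK xK']]|disj] := pselect (exists x, x \in K.1 /\ x \in K'.1).
  suff -> : K = K' by exists M.
  by rewrite (animal_cluster aniK fK xK) [RHS](animal_cluster aniK' fK' xK').
have bMK x : x \in K.1 -> bdry a M x = false.
  move=> xK; rewrite bM; apply/negbTE; rewrite negb_and; apply/orP; right.
  by apply/negP => xK'; apply: disj; exists x; split => //; exact: subK'.
have KM x : x \in K.1 -> x \in M.
  move=> xK; have := cK e x (subK _ eK) xK.
  suff h : conn s a (fun z => z \in K.2) e x -> x \in K.1 /\ x \in M by move=> /h[].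
  elim=> [|u _ [uK uM]|u _ [uK uM] uK2]; first by split; [exact: subK|exact: LM].
  - rewrite sK uK; split => //.
    have := bMK u uK; rewrite /bdry uM => /negbFE auM.
    by rewrite -[u]aK -[s _]/(s (a (a u))) fM.
  - split; first by apply: subK; rewrite aK2.
    by have := bMK u uK; rewrite /bdry uM => /negbFE.
have fX : face_closed s a (A `|` M)%fset by move=> x; rewrite !inE fA fM.
have [|x [xX axX]] := bdry_nonempty (d := e) H fX; first by rewrite inE LA.
move: axX; rewrite inE negb_or => /andP[axA axM].
have noA : x \notin A.
  apply/negP => xA; have xK : x \in K.2 by apply: bA; rewrite /bdry xA (negbTE axA).
  by move/negP: axM; apply; apply: KM; apply: subK; rewrite aK2.
move: xX; rewrite inE (negbTE noA) /= => xM.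
have : bdry a M x by rewrite /bdry xM (negbTE axM).
rewrite bM => /andP[+ _]; rewrite /bdry.
rewrite (negbTE (contra (@LA x) noA)) /= => /LM axM'.
by rewrite axM' in axM.
Qed.

Lemma surrounds_edge K L : surrounds s a K L -> L.1 != fset0 ->
  exists e, e \in K.2 /\ e \in L.1.
Proof.
move=> [A [fA bA LA]] /fset0Pn[d dL].
have [e [eA aeA]] := bdry_nonempty H fA (LA _ dL).
have : bdry a A e by rewrite /bdry eA (negbTE aeA).
rewrite bA => /andP[be eK]; exists e; split => //; move: be; rewrite /bdry.
by rewrite (negbTE (contra (@LA (a e)) aeA)) addbF.
Qed.

Lemma bdry_vertex_sum L x : face_closed s a L ->
  \big[addb/false]_(i < m) bdry a L (iter i s x) = false.
Proof.
move=> fL.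
rewrite (eq_bigr (fun i : 'I_m => (iter i s x \in L) (+) (iter i.+1 s x \in L))).
  by rewrite big_split /= (orbit_sum_shift H (fun y => y \in L)) addbb.
by move=> i _; rewrite /bdry iterS -(fL (a (iter i s x))) aK.
Qed.

Lemma orbit_sum_iter (f : T -> bool) k x :
  \big[addb/false]_(i < m) f (iter i s (iter k s x)) = \big[addb/false]_(i < m) f (iter i s x).
Proof.
elim: k x => [//|k IH] x; rewrite iterSr IH -(orbit_sum_shift H f x).
by apply: eq_bigr => i _; rewrite -iterSr.
Qed.

Section Component.
Variable K : {fset T} * {fset T}.
Hypothesis aniK : animal s a K.
Hypothesis fK : fits o K.

Let sK : forall x, (s x \in K.1) = (x \in K.1). Proof. by case: aniK. Qed.
Let subK : {subset K.2 <= K.1}. Proof. by case: aniK. Qed.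
Let aK2 : forall x, (a x \in K.2) = (x \in K.2). Proof. by case: aniK. Qed.

Definition inner (L : {fset T} * {fset T}) : Prop :=
  [/\ animal face a L, fits co L & surrounds s a K L].

(** By [surrounds_edge] a surrounded dual cluster contains a dart of [K.2], so the finitely many
    dual clusters at these darts are enough candidates. *)
Definition inners : {fset ({fset T} * {fset T})} :=
  [fset L in [fset cluster face a co e | e in K.2] | `[< inner L >]]%fset.

Lemma innersP L : L \in inners <-> inner L.
Proof.
rewrite !inE /=; split => [/andP[_ /asboolP]//|iL].
apply/andP; split; last exact/asboolP.
have [aniL fL sL] := iL.
have [e [eK eL]] : exists e, e \in K.2 /\ e \in L.1.
  by apply: surrounds_edge sL _; apply/fset0Pn; case: aniL.
by apply/imfsetP; exists e => //=; exact: (animal_cluster aniL fL eL).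
Qed.

Lemma inner_eq L L' x : inner L -> inner L' -> x \in L.1 -> x \in L'.1 -> L = L'.
Proof.
move=> [aL fL _] [aL' fL' _] xL xL'.
by rewrite (animal_cluster aL fL xL) [RHS](animal_cluster aL' fL' xL').
Qed.

(* Euler's formula for [K]: the parts in [K] of the boundaries of the dual
   clusters whose outer boundary lies in [K] form a basis of its cycle space. *)
Lemma card_inners :
  (#|` inners| + #|` vertex_reps m s K.1| = #|` edge_reps a K.2| + 1)%N.
Proof.
pose N (L : {fset T} * {fset T}) (e : T) := bdry a L.1 e.
(* The mod 2 incidence of edges and vertices; a loop would contribute zero. *)
pose M e x := (vertex_rep m s e == x) (+) (vertex_rep m s (a e) == x).
have repX e : e \in K.1 -> vertex_rep m s e \in vertex_reps m s K.1.
  move=> eK; rewrite !inE /= (vertex_repK H) eqxx andbT.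
  have [k _ ->] := vertex_repP H e.
  by elim: k => // k IH; rewrite iterS sK.
have sumX (u : T -> bool) y : y \in vertex_reps m s K.1 ->
    \sum_(x <- vertex_reps m s K.1) (y == x) * u x = u y.
  move=> yX; rewrite (big_fsetD1 y) //= eqxx mul1r big_seq big1 ?addr0 // => x.
  by rewrite !inE eq_sym => /andP[/negbTE-> _]; rewrite mul0r.
have sumM (z : T -> bool) x : x \in vertex_reps m s K.1 -> (forall e, z (a e) = z e) ->
    \sum_(e <- edge_reps a K.2) z e * M e x =
    \big[addb/false]_(i < m) ((iter i s x \in K.2) && z (iter i s x)).
  move=> xX za; have /andP[xK /eqP xr] : (x \in K.1) && (vertex_rep m s x == x).
    by move: xX; rewrite !inE.
  transitivity (\big[addb/false]_(e <- K.2) (z e && (vertex_rep m s e == x))).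
    rewrite (big_edge_reps H _ _ aK2); apply: eq_bigr => e _.
    by rewrite za /M; case: (z e).
  transitivity (\big[addb/false]_(e <- K.1) ((e \in K.2) && (z e && (vertex_rep m s e == x)))).
    rewrite [RHS](big_fsetID _ (fun e => e \in K.2)) /= [X in _ (+) X]big1_fset ?addbF; last first.
      by move=> e; rewrite !inE => /andP[_ /negbTE->].
    have -> : [fset e in K.1 | e \in K.2]%fset = K.2.
      by apply/fsetP => e; rewrite !inE /= andbC; case eK: (e \in K.2) => //=; exact: subK.
    by apply: eq_big_seq => e ->.
  rewrite (big_vertex_reps H _ _ sK) (big_fsetD1 x) //= [X in _ (+) X]big1_fset ?addbF; last first.
    move=> y; rewrite !inE => /and3P[yx _ /eqP yr] _; apply: big1 => i _.
    by rewrite (vertex_rep_iter H) yr (negbTE yx) !andbF.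
  by apply: eq_bigr => i _; rewrite (vertex_rep_iter H) xr eqxx andbT.
apply: (@exact_card_fset bool _ _ _ inners (edge_reps a K.2) (vertex_reps m s K.1) N M).
- move=> u uN.
  have uK b : b \in K.2 -> \sum_(L <- inners) u L * N L b = 0.
    move=> bK.
    have [|bn] := boolP (b \in edge_reps a K.2); first exact: uN.
    rewrite -[RHS](uN (a b)); last first.
      move: bn; rewrite !inE /= aK2 bK aK /= -leqNgt leq_eqVlt => /orP[|//].
      by rewrite (inj_eq (pcan_inj (@choice.pickleK T))) (negbTE (map_a_neq H _)).
    by apply: eq_bigr => L _; rewrite /N (bdry_flip H).
  have exA L : exists A, inner L -> [/\ face_closed s a A,
      forall e, bdry a A e = bdry a L.1 e && (e \in K.2) & {subset L.1 <= A}].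
    have [[_ _ [A AP]]|nL] := pselect (inner L); first by exists A.
    by exists fset0 => /nL.
  have [A AP] := choice exA.
  move=> L1 L1S; apply/negbTE/negP => uL1.
  (* Some edge leaves the union of the fillings of the chosen dual clusters. It lies in [K] and
     bounds exactly one chosen [L], so the vanishing sum would equal 1 there. *)
  pose X := (\bigcup_(L <- inners | u L) A L)%fset.
  have XP x : reflect (exists L, [/\ inner L, u L & x \in A L]) (x \in X).
    apply: (iffP idP) => [/bigfcupP[L /andP[/innersP iL uL] xL]|[L [/innersP iL uL xL]]].
      by exists L.
    by apply/bigfcupP; exists L => //; rewrite iL uL.
  have fX : face_closed s a X.
    move=> x; apply/XP/XP => -[L [iL uL xL]]; exists L; split => //; have [fA _ _] := AP L iL.
      by rewrite -fA.
    by rewrite fA.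
  have iL1 : inner L1 by exact/innersP.
  have [d dL1] : exists d, d \in L1.1 by case: iL1 => -[].
  have [|e [/XP[L0 [iL0 uL0 eA]] /XP aeX]] := bdry_nonempty (d := d) H fX.
    by apply/XP; exists L1; split => //; case: (AP L1 iL1) => _ _; apply.
  have notA L : inner L -> u L -> a e \notin A L.
    by move=> iL uL; apply/negP => aeA; apply: aeX; exists L.
  have notL L : inner L -> u L -> a e \notin L.1.
    by move=> iL uL; apply: contra (notA L iL uL); case: (AP L iL) => _ _; apply.
  have [_ /(_ e) bA0 _] := AP L0 iL0.
  move: bA0; rewrite /bdry eA (negbTE (notA _ iL0 uL0)) (negbTE (notL _ iL0 uL0)) !addbF /=.
  move=> /esym/andP[eL0 eK].
  have := uK e eK; rewrite (big_fsetD1 L0) /=; last exact/innersP.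
  rewrite big_seq big1 => [|L].
    by rewrite addr0 uL0 /N /bdry eL0 (negbTE (notL _ iL0 uL0)).
  rewrite in_fsetD1 => /andP[LL0 /innersP iL].
  have [uL|_] := boolP (u L); last by rewrite mul0r.
  rewrite /N /bdry (negbTE (notL _ iL uL)) addbF.
  have /negbTE-> : e \notin L.1; last by rewrite mulr0.
  by apply/negP => eL; move: LL0; rewrite (inner_eq iL iL0 eL eL0) eqxx.
(* Boundaries are cycles; at a vertex of [K] the boundary edges of [L] are open, so restricting to
   [K.2] loses nothing. *)
- move=> L x /innersP[aniL fL _] xX.
  rewrite sumM //; last by move=> e; rewrite /N (bdry_flip H).
  rewrite -[RHS](bdry_vertex_sum x (dual_closed aniL)); apply: eq_bigr => i _.
  rewrite /N; case be: (bdry a L.1 (iter i s x)); rewrite ?andbF // andbT.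
  rewrite -fK; first exact: (dual_bdry_open H oa aniL fL be).
  have : x \in K.1 by move: xX; rewrite !inE => /andP[].
  by elim: (nat_of_ord i) => // k IH xK; rewrite iterS sK IH.
- move=> z zM.
  (* The cycle [z] matters only on representatives; it is extended to both darts before being
     filled. *)
  pose z' x := if x \in edge_reps a K.2 then z x else z (a x).
  have z'a e : e \in K.2 -> z' (a e) = z' e.
    move=> eK; rewrite /z' !inE /= aK2 eK aK /=.
    case: (ltngtP (choice.pickle e) (choice.pickle (a e))) => // /eqP.
    by rewrite (inj_eq (pcan_inj (@choice.pickleK T))) eq_sym (negbTE (map_a_neq H _)).
  pose Z := [fset x in K.2 | z' x]%fset.
  have ZE x : (x \in Z) = (x \in K.2) && z' x by rewrite !inE.
  have aZ x : (a x \in Z) = (x \in Z).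
    by rewrite !ZE aK2; case xK: (x \in K.2) => //=; exact: z'a.
  have eZ : even_set m s Z.
    move=> x; have [xK|xK] := boolP (x \in K.1); last first.
      rewrite big1 // => i _; rewrite ZE; apply/negbTE; rewrite negb_and; apply/orP; left.
      apply: contra xK => /subK; elim: (nat_of_ord i) => // k IH.
      by rewrite iterS sK.
    have [k _ e] := vertex_repP H x.
    rewrite -(orbit_sum_iter (fun y => y \in Z) k) -e.
    rewrite -[RHS](zM _ (repX _ xK)).
    transitivity (\sum_(e <- edge_reps a K.2) (e \in Z) * M e (vertex_rep m s x)).
      rewrite sumM //; last exact: repX.
      by apply: eq_bigr => i _; rewrite ZE; case: (_ \in K.2).
    apply: eq_big_seq => y yY; rewrite ZE /z' yY.
    by have /andP[-> _] : (y \in K.2) && (choice.pickle y < choice.pickle (a y))%N; first by move: yY; rewrite !inE.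
  have [A fA AZ] := even_set_bdry H aZ eZ.
  have bA x : bdry a A x -> x \in K.2 by rewrite -AZ ZE => /andP[].
  pose u (L : {fset T} * {fset T}) := `[< {subset L.1 <= A} >].
  (* On the darts of [K], the filling [A] is a disjoint union of inner clusters: a dual cluster
     starting in [A] cannot cross its open boundary, so it is finite, and [surrounds_inside] shows
     that [K] surrounds it. *)
  have uS e : e \in K.2 -> (e \in A) = \sum_(L <- inners) u L * (e \in L.1).
    move=> eK; have [eA|eA] := boolP (e \in A); last first.
      rewrite big1 // => L _; rewrite /u; case: asboolP => [LA|_]; last by rewrite mul0r.
      by rewrite (negbTE (contra (@LA e) eA)) mulr0.
    have connA y : conn face a co e y -> y \in A.
      elim=> [//|x _ xA|x _ xA ox]; first by rewrite /= fA.
      apply: contraT => ax; move: ox; rewrite /= fK ?bA //; first by rewrite /bdry xA (negbTE ax).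
      by apply/subK/bA; rewrite /bdry xA (negbTE ax).
    have fin : finite_set [set y | conn face a co e y].
      by apply: sub_finite_set (finite_fset A) => y /= /connA.
    have [aniL fL mL _] := cluster_animal m_gt0 (map_face_iter H) aK coa fin.
    set L0 := cluster face a co e in aniL fL mL.
    have L0A : {subset L0.1 <= A} by move=> y; rewrite mL => /asboolP/connA.
    have eL0 : e \in L0.1 by rewrite mL; apply/asboolP; exact: conn_refl.
    have iL0 : inner L0.
      by split => //; exact: (surrounds_inside aniK fK fA bA aniL fL L0A eL0 eK).
    rewrite (big_fsetD1 L0) /=; last exact/innersP.
    have -> : u L0 = true by exact/asboolP.
    rewrite eL0 big_seq big1 ?addr0 // => L.
    rewrite in_fsetD1 => /andP[LL0 /innersP iL].
    have /negbTE-> : e \notin L.1; last by rewrite mulr0.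
    by apply/negP => eL; move: LL0; rewrite (inner_eq iL iL0 eL eL0) eqxx.
  exists u => b bY.
  have bK : b \in K.2 by move: bY; rewrite !inE => /andP[].
  have -> : z b = bdry a A b by rewrite -AZ ZE bK /z' bY.
  rewrite /bdry uS // uS ?aK2 // -big_split /=; apply: eq_bigr => L _.
  by rewrite /N /bdry; case: (u L).
- move=> b bY; have bK : b \in K.2 by move: bY; rewrite !inE => /andP[].
  have one y : y \in K.1 -> \sum_(c <- vertex_reps m s K.1) (vertex_rep m s y == c) = true.
    move=> yK; rewrite -[RHS](sumX (fun=> true) _ (repX _ yK)).
    by apply: eq_bigr => c _; rewrite mulr1.
  rewrite big_split /= one ?one //; first by apply: subK; rewrite aK2.
  exact: subK.
(* A function with equal values at the ends of every edge is constant, as [K] is connected. *)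
- move=> u uM.
  have uE e : e \in K.2 -> u (vertex_rep m s (a e)) = u (vertex_rep m s e).
    have half b : b \in edge_reps a K.2 -> u (vertex_rep m s (a b)) = u (vertex_rep m s b).
      move=> bY; have bK : b \in K.2 by move: bY; rewrite !inE => /andP[].
      have := uM b bY.
      rewrite (eq_bigr (fun c => (vertex_rep m s b == c) * u c + (vertex_rep m s (a b) == c) * u c)); last first.
        by move=> c _; rewrite -mulrDl.
      rewrite big_split /= !sumX; last 2 first.
      + by apply: repX; apply: subK; rewrite aK2.
      + exact/repX/subK.
      by case: (u _); case: (u _).
    move=> eK; have [|eY] := boolP (e \in edge_reps a K.2); first exact: half.
    have := half (a e); rewrite aK => -> //; rewrite !inE /= aK2 eK aK /=.
    move: eY; rewrite !inE /= eK /= -leqNgt leq_eqVlt => /orP[|//].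
    by rewrite (inj_eq (pcan_inj (@choice.pickleK T))) (negbTE (map_a_neq H _)).
  have uC x y : x \in K.1 -> y \in K.1 -> u (vertex_rep m s x) = u (vertex_rep m s y).
    move=> xK yK; have [_ _ _ _ cK] := aniK.
    elim: (cK x y xK yK) => [//|w _ ->|w _ -> wK]; first by rewrite (vertex_rep_s H).
    by rewrite uE.
  move=> x y; rewrite !inE /= => /andP[xK /eqP xr] /andP[yK /eqP yr].
  by rewrite -xr -yr; exact: uC.
- have [d dK] : exists d, d \in K.1 by case: aniK.
  by apply/fset0Pn; exists (vertex_rep m s d); exact: repX.
Qed.

End Component.
End Euler.

(** * Sums, counting and mass transport *)

Section Sums.
Variable R : realType.
Local Open Scope ereal_scope.

Lemma esumZ (I : choiceType) (c : R) (f : I -> \bar R) : (0 <= c)%R ->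
  (forall i, 0 <= f i) ->
  \esum_(i in [set: I]) (c%:E * f i) = c%:E * \esum_(i in [set: I]) f i.
Proof.
have half (b : R) (g : I -> \bar R) : (0 <= b)%R -> (forall i, 0 <= g i) ->
    \esum_(i in [set: I]) (b%:E * g i) <= b%:E * \esum_(i in [set: I]) g i.
  move=> b0 g0; apply: ge_ereal_sup => _ [X [finX _] <-].
  rewrite fsbig_finite//= -ge0_sume_distrr; last by move=> i _; exact: g0.
  apply: lee_wpmul2l; first by rewrite lee_fin.
  by apply: esum_ge; exists X => //; rewrite fsbig_finite.
rewrite le_eqVlt => /orP[/eqP <- f0|c0 f0].
  by rewrite mul0e esum1 // => i _; rewrite mul0e.
apply/eqP; rewrite eq_le half ?(ltW c0) //=.
have cf0 i : 0 <= c%:E * f i by rewrite mule_ge0 // lee_fin ltW.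
have := half c^-1%R (fun i => c%:E * f i); rewrite invr_ge0 (ltW c0) => /(_ isT cf0).
rewrite (eq_esum (b := f)); last first.
  by move=> i _; rewrite muleA -EFinM mulVf ?mul1e // gt_eqF.
move=> h; have := lee_wpmul2l (x := c%:E) _ h; rewrite lee_fin (ltW c0) => /(_ isT).
by rewrite muleA -EFinM divff ?mul1e // gt_eqF.
Qed.

Lemma esum_swap (I J : choiceType) (f : I -> J -> \bar R) : (forall i j, 0 <= f i j) ->
  \esum_(i in [set: I]) \esum_(j in [set: J]) f i j =
  \esum_(j in [set: J]) \esum_(i in [set: I]) f i j.
Proof.
move=> f0; rewrite !esum_esum //.
rewrite (@reindex_esum R _ _ ([set: J] `*`` (fun=> [set: I])) _ (fun k : J * I => (k.2, k.1))) //.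
split=> // [[x y] [x' y'] _ _ /= [-> ->] //|[x y] _]; by exists (y, x).
Qed.

Lemma esum_bij (I J : choiceType) (e : I -> J) (g : J -> I) (f : J -> \bar R) :
  cancel e g -> cancel g e ->
  \esum_(j in [set: J]) f j = \esum_(i in [set: I]) f (e i).
Proof.
move=> eg ge; apply: reindex_esum; split => // [x y _ _ /(congr1 g)|y _].
  by rewrite !eg.
by exists (g y).
Qed.

Lemma esum_fset_const (I : choiceType) (X : {fset I}) (c : \bar R) : 0 <= c ->
  \esum_(i in [set: I]) ((i \in X)%:R%:E * c) = #|` X|%:R%:E * c.
Proof.
move=> c0; rewrite (eq_esum (b := fun i => if i \in [set` X] then c else 0)); last first.
  by move=> i _; rewrite mem_setE; case: (i \in X); rewrite ?mul1e ?mul0e.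
rewrite -esum_mkcond esum_fset // fsbig_finite //= set_fsetK big_const_seq count_predT.
by elim: #|` X| => [|n IH] /=; rewrite ?mul0e // IH -natr1 EFinD ge0_muleDl ?lee_fin // mul1e addeC.
Qed.

Lemma esum_nat (I : countType) (f : I -> \bar R) : (forall i, 0 <= f i) ->
  \esum_(i in [set: I]) f i =
  \sum_(n <oo) (if @choice.pickle_inv I n is Some i then f i else 0).
Proof.
move=> f0; rewrite nneseries_esumT; last by move=> n; case: choice.pickle_inv.
pose h n := if @choice.pickle_inv I n is Some i then f i else 0.
have inv i : choice.pickle_inv (@choice.pickle I i) = Some i by exact: choice.pickleK_inv.
rewrite -/h (eq_esum (b := fun n => if n \in range (@choice.pickle I) then h n else 0)); last first.
  move=> n _; rewrite /h; case e: (choice.pickle_inv n) => [i|]; last by case: ifP.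
  rewrite ifT // inE; exists i => //.
  by have := @choice.pickle_invK I n; rewrite /ocancel e.
rewrite -esum_mkcond (@reindex_esum R _ _ [set: I] _ (@choice.pickle I)) //.
  by apply: eq_esum => i _; rewrite /h inv.
split => // x y _ _; exact: (pcan_inj (@choice.pickleK I)).
Qed.

(** Tonelli: integrate over [B] the number of indices [i] with [X i w], which equals [c] off the
    null set [N]. *)
Lemma counting (d : measure_display) (W : measurableType d) (P : probability W R)
    (I : countType) (X : I -> set W) (B N : set W) (c : nat) :
  measurable B -> (forall i, measurable (X i)) -> measurable N -> P N = 0 ->
  (forall w, B w -> ~ N w -> exists S : {fset I}, #|` S| = c /\ forall i, X i w <-> i \in S) ->
  \esum_(i in [set: I]) P (B `&` X i) = c%:R%:E * P B.
Proof.
move=> mB mX mN PN H.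
pose f n w : \bar R := if @choice.pickle_inv I n is Some i then (\1_(X i) w)%:E else 0.
have mf n : measurable_fun B (f n).
  rewrite /f; case: (choice.pickle_inv n) => [i|]; last exact: measurable_cst.
  by apply/measurable_EFinP; exact: measurable_indic.
have f0 n w : B w -> 0 <= f n w.
  by rewrite /f; case: (choice.pickle_inv n) => [i|] //; rewrite lee_fin.
transitivity (\int[P]_(w in B) \sum_(n <oo) f n w).
  rewrite integral_nneseries // esum_nat //; apply: eq_eseriesr => n _.
  rewrite /f; case: (choice.pickle_inv n) => [i|]; last by rewrite integral0.
  by rewrite integral_indic // setIC.
transitivity (\int[P]_(w in B) c%:R%:E).
  apply: ge0_ae_eq_integral => //.
  - by apply: ge0_emeasurable_sum => [k x Bx _|k _]; [exact: f0|exact: mf].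
  - by move=> w Bw; apply: nneseries_ge0 => n _ _; exact: f0.
  - exists N; split => // w /= nw; apply: contrapT => Nw; apply: nw => Bw.
    have [S [<- SP]] := H w Bw Nw.
    rewrite -[RHS]mule1 -(esum_fset_const (I := I) S) // esum_nat //; apply: eq_eseriesr => n _.
    rewrite /f; case: (choice.pickle_inv n) => [i|] //.
    rewrite mule1 indicE; congr ((_%:R)%:E); congr (nat_of_bool _).
    by apply/idP/idP; rewrite inE => /SP.
by rewrite integral_cst.
Qed.

End Sums.

Section MassTransport.
Variables (R : realType) (m : nat) (T : countType) (s a : T -> T).
Hypothesis H : regular_map m s a.
Local Open Scope ereal_scope.

(* The image of [d0] under the automorphism taking [d] to [d0] is an involution
   of [d] that exchanges the two sums. *)
Lemma mass_transport (F : T -> T -> \bar R) d0 :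
  (forall d1 d2 x y, F (autom H d1 d2 x) (autom H d1 d2 y) = F x y) ->
  \esum_(d in [set: T]) F d0 d = \esum_(d in [set: T]) F d d0.
Proof.
move=> inv.
pose j d := autom H d d0 d0.
have jK : involutive j.
  move=> d; rewrite {2}/j /autom; move: (wordto H d d0) (wordtoP H d d0) => w wd.
  rewrite /j; have {3}-> : d0 = act s a (winv m w) (act s a w d0) by rewrite (act_winv H).
  by rewrite (autom_act H) -[X in act _ _ _ X]wd (act_winv H).
rewrite (esum_bij (fun d => F d d0) jK jK); apply: eq_esum => d _.
by rewrite -(inv d d0) (automE H).
Qed.
End MassTransport.

(** * Cylinder events *)

Section Relabel.
Variables (T : choiceType) (g g' : T -> T).
Hypothesis gK : cancel g g'.
Hypothesis g'K : cancel g' g.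

Definition relabel (C : {fset T} * {fset T}) : {fset T} * {fset T} :=
  ([fset g x | x in C.1], [fset g x | x in C.2])%fset.

Lemma mem_relabel (X : {fset T}) x : (x \in [fset g y | y in X]%fset) = (g' x \in X).
Proof.
by rewrite -{1}(g'K x) mem_imfset //; exact: can_inj gK.
Qed.

Lemma card_relabel (X : {fset T}) : #|` [fset g y | y in X]%fset| = #|` X|.
Proof. by rewrite card_imfset //; exact: can_inj gK. Qed.

Lemma animal_relabel (f f' a : T -> T) C : (forall x, g (f x) = f' (g x)) ->
  (forall x, g (a x) = a (g x)) -> animal f a C -> animal f' a (relabel C).
Proof.
move=> gf ga [[d dC] fC sC aC cC].
have g'f x : g' (f' x) = f (g' x) by rewrite -{1}(g'K x) -gf gK.
have g'a x : g' (a x) = a (g' x) by rewrite -{1}(g'K x) -ga gK.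
split => /=.
- by exists (g d); rewrite mem_relabel gK.
- by move=> x; rewrite !mem_relabel g'f fC.
- by move=> x; rewrite !mem_relabel; exact: sC.
- by move=> x; rewrite !mem_relabel g'a aC.
- move=> x y; rewrite !mem_relabel => xC yC.
  rewrite -(g'K y); elim: (cC _ _ xC yC) => [|u _ IH|u _ IH uC].
  + by rewrite g'K; exact: conn_refl.
  + by rewrite gf; exact: conn_rot.
  + by rewrite ga; apply: conn_flip; rewrite // mem_relabel gK.
Qed.

End Relabel.

Lemma relabelK (T : choiceType) (g g' : T -> T) : cancel g g' ->
  cancel (relabel g) (relabel g').
Proof.
move=> gK [V E]; rewrite /relabel /= -!imfset_comp.
by congr (_, _); rewrite -[RHS]imfset_id; apply: eq_imfset => // x /=; rewrite gK.
Qed.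

Lemma surrounds_relabel (T : countType) (s a g g' : T -> T) K L :
  cancel g g' -> cancel g' g -> (forall x, g (s x) = s (g x)) ->
  (forall x, g (a x) = a (g x)) ->
  surrounds s a K L -> surrounds s a (relabel g K) (relabel g L).
Proof.
move=> gK g'K gs ga [A [fA bA LA]].
have g's x : g' (s x) = s (g' x) by rewrite -{1}(g'K x) -gs gK.
have g'a x : g' (a x) = a (g' x) by rewrite -{1}(g'K x) -ga gK.
exists [fset g x | x in A]%fset; split => /=.
- by move=> x; rewrite !(mem_relabel gK g'K) g's g'a fA.
- by move=> x; rewrite /bdry !(mem_relabel gK g'K) g'a; exact: bA.
- by move=> x; rewrite !(mem_relabel gK g'K); exact: LA.
Qed.

Lemma card_imfset_eq (I : choiceType) (A B : choiceType) (X : {fset I}) (u : I -> A) (v : I -> B) :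
  {in X &, forall x y, u x = u y <-> v x = v y} ->
  #|` [fset u x | x in X]%fset| = #|` [fset v x | x in X]%fset|.
Proof.
have half (A' B' : choiceType) (u' : I -> A') (v' : I -> B') :
    {in X &, forall x y, u' x = u' y -> v' x = v' y} ->
    (#|` [fset v' x | x in X]%fset| <= #|` [fset u' x | x in X]%fset|)%N.
  move=> uv; have [->|/fset0Pn[x0 x0X]] := eqVneq X fset0.
    by rewrite (_ : [fset v' x | x in fset0]%fset = fset0) ?cardfs0 //; apply/fsetP => b; rewrite !inE; apply/imfsetP => -[].
  pose h (c : A') : B' := if pselect (exists2 x, x \in X & u' x = c) is left e then v' (s2val (cid2 e)) else v' x0.
  have hE x : x \in X -> h (u' x) = v' x.
    move=> xX; rewrite /h; case: pselect => [e|[]]; last by exists x.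
    by case: (cid2 e) => y yX yx /=; exact: uv.
  rewrite (_ : [fset v' x | x in X]%fset = [fset h c | c in [fset u' x | x in X]]%fset).
    exact: leq_imfset_card.
  apply/fsetP => b; apply/imfsetP/imfsetP => /= -[x xX ->].
    by exists (u' x); rewrite ?hE // in_imfset.
  by move: xX => /imfsetP[y /= yX ->]; exists y => //; rewrite hE.
by move=> uv; apply/eqP; rewrite eqn_leq !half // => x y xX yX /uv; apply.
Qed.

Section Cylinders.
Variables (R : realType) (G : graph) (p : R) (P : probability (config G) R).
Hypothesis bP : bernoulli_percolation p P.

Lemma measurable_open_edge (e : edge G) : measurable (@open_edge G e : set (config G)).
Proof. by apply: sub_gen_smallest; exists e. Qed.

(** Independence is assumed for open edges only. A closed edge is introduced by subtracting the
    event in which it is open. *)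
Lemma cylinder_prob (X Y : seq (edge G)) : uniq (X ++ Y) ->
  P [set w : config G | (forall e, e \in X -> (w : set (edge G)) e) /\
                        (forall e, e \in Y -> ~ (w : set (edge G)) e)] =
  (p ^+ size X * (1 - p) ^+ size Y)%:E.
Proof.
elim: Y X => [|y Y IH] X.
  rewrite cats0 => uX.
  rewrite [X in P X](_ : _ = \bigcap_(e in [set` X]) open_edge e); last first.
    by apply/seteqP; split => w /=; [move=> [Xw _] e; exact: Xw|move=> Xw; split => // e; exact: Xw].
  rewrite bP.2 // (eq_bigr (fun=> p%:E)); last by move=> e _; exact: bP.1.
  rewrite mulr1; elim: (X) => [|e s IHs]; first by rewrite big_nil.
  by rewrite big_cons IHs -EFinM -exprS.
rewrite -cat_rcons => uXY.
have uX : uniq (X ++ Y).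
  by move: uXY; rewrite cat_rcons; rewrite !cat_uniq /= negb_or -!andbA => /and5P[-> _ -> _ ->].
set A := [set w : config G | _].
pose B (X : seq (edge G)) := [set w : config G | (forall e, e \in X -> (w : set (edge G)) e) /\
                        (forall e, e \in Y -> ~ (w : set (edge G)) e)].
have -> : A = B X `\` B (rcons X y).
  apply/seteqP; split => w /=.
    move=> [Xw Yw]; split; first by split => // e eY; apply: Yw; rewrite inE eY orbT.
    by move=> [/(_ y)]; rewrite mem_rcons mem_head => /(_ isT) wy _; apply: (Yw y); rewrite ?mem_head.
  move=> [[Xw Yw] nw]; split => // e; rewrite inE => /orP[/eqP->|]; last exact: Yw.
  move=> wy; apply: nw; split => // f; rewrite mem_rcons inE => /orP[/eqP->//|]; exact: Xw.
have mB Z : measurable (B Z).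
  rewrite (_ : B Z = \bigcap_(e in [set` Z]) open_edge e `&` \bigcap_(e in [set` Y]) ~` open_edge e); last first.
    by apply/seteqP; split => w /= [].
  apply: measurableI; apply: fin_bigcap_measurable => // e _; last apply: measurableC;
    exact: measurable_open_edge.
have -> : P (B X `\` B (rcons X y)) = (P (B X) - P (B X `&` B (rcons X y)))%E.
  by apply: measureD => //; apply: le_lt_trans (probability_le1 _ (mB _)) _; rewrite ltry.
have -> : B X `&` B (rcons X y) = B (rcons X y).
  apply/setIidPr => w [Xw Yw]; split => // e eX; apply: Xw; rewrite mem_rcons inE eX orbT //.
have PB Z : uniq (Z ++ Y) -> P (B Z) = (p ^+ size Z * (1 - p) ^+ size Y)%:E by exact: IH.
rewrite !PB // -EFinB size_rcons; congr (_%:E).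
by rewrite !exprS; ring.
Qed.

Variables (T : countType) (s a : T -> T) (eg : T -> edge G).
Hypothesis aK : involutive a.
Hypothesis egP : forall x y, eg x = eg y <-> x = y \/ x = a y.

(** Counts edges, not darts: an edge outside the cluster may have one or both of its darts in
    [C.1]. *)
Definition edge_count (X : {fset T}) : nat := #|` [fset eg x | x in X]%fset|.

Definition pattern (X Y : {fset T}) : set (config G) :=
  [set w | (forall x, x \in X -> (w : set (edge G)) (eg x)) /\
           (forall x, x \in Y -> ~ (w : set (edge G)) (eg x))].

Lemma measurable_pattern X Y : measurable (pattern X Y).
Proof.
rewrite (_ : pattern X Y = \bigcap_(e in [set` X]) open_edge (eg e) `&` \bigcap_(e in [set` Y]) ~` open_edge (eg e)); last first.
  by apply/seteqP; split => w /= [].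
apply: measurableI; apply: fin_bigcap_measurable => // e _; last apply: measurableC;
  exact: measurable_open_edge.
Qed.

Lemma pattern_prob (X Y : {fset T}) :
  (forall x y, x \in X -> y \in Y -> eg x <> eg y) ->
  P (pattern X Y) = (p ^+ edge_count X * (1 - p) ^+ edge_count Y)%:E.
Proof.
move=> dXY; have := @cylinder_prob [fset eg x | x in X]%fset [fset eg x | x in Y]%fset.
rewrite -/(edge_count X) -/(edge_count Y) => <-; last first.
  rewrite cat_uniq !fset_uniq andbT /=; apply/hasPn => _ /imfsetP[y /= yY ->].
  by apply/negP => /imfsetP[x /= xX e]; exact: (dXY x y).
congr (P _); apply/seteqP; split => w [Xw Yw]; split.
- by move=> _ /imfsetP[x /= xX ->]; exact: Xw.
- by move=> _ /imfsetP[x /= xX ->]; exact: Yw.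
- by move=> x xX; apply: Xw; exact: in_imfset.
- by move=> x xX; apply: Yw; exact: in_imfset.
Qed.

Lemma edge_count_relabel (g g' : T -> T) X : cancel g g' -> (forall x, g (a x) = a (g x)) ->
  edge_count [fset g x | x in X]%fset = edge_count X.
Proof.
move=> gK ga; rewrite /edge_count -imfset_comp.
apply: card_imfset_eq => x y _ _ /=; split=> /egP e; apply/egP.
  by case: e => [/(can_inj gK)|]; [left|rewrite -ga => /(can_inj gK); right].
by case: e => ->; [left|right; rewrite ga].
Qed.

Lemma pattern_relabel (g g' : T -> T) X Y : cancel g g' -> cancel g' g ->
  (forall x, g (a x) = a (g x)) ->
  P (pattern [fset g x | x in X]%fset [fset g x | x in Y]%fset) = P (pattern X Y).
Proof.
move=> gK g'K ga.
have [[x [y [xX yY e]]]|dXY] := pselect (exists x y, [/\ x \in X, y \in Y & eg x = eg y]).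
  have -> : pattern X Y = set0.
    by apply/seteqP; split => // w [/(_ x xX) wx /(_ y yY)]; rewrite -e.
  congr (P _); apply/seteqP; split => // w [] /(_ (g x)); rewrite (mem_relabel gK g'K) gK => /(_ xX) wx.
  move=> /(_ (g y)); rewrite (mem_relabel gK g'K) gK => /(_ yY); apply.
  suff <- : eg (g x) = eg (g y) by [].
  by apply/egP; move/egP : e => [->|->]; [left|right; rewrite ga].
rewrite !pattern_prob ?(edge_count_relabel _ gK ga) //.
- by move=> x y xX yY e; apply: dXY; exists x, y.
- move=> x y; rewrite !(mem_relabel gK g'K) => xX yY e; apply: dXY; exists (g' x), (g' y); split => //.
  apply/egP; move/egP : e => [->|->]; first by left.
  by right; rewrite -{1}(g'K y) -ga gK.
Qed.

End Cylinders.

(** * The identity between cluster densities *)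

Section Identity.
Variables (R : realType) (G : graph) (p : R) (P : probability (config G) R).
Hypothesis bP : bernoulli_percolation p P.
Variables (m : nat) (T : countType) (s a : T -> T) (eg : T -> edge G).
Hypothesis H : regular_map m s a.
Hypothesis egP : forall x y, eg x = eg y <-> x = y \/ x = a y.

Local Notation face := (s \o a).
Local Notation I := ({fset T} * {fset T})%type.
Local Open Scope ereal_scope.

Let m_gt0 : (0 < m)%N. Proof. exact: ltnW (map_m H). Qed.
Let aK := map_aK H.

Definition open_darts (w : config G) (x : T) : bool := `[< (w : set (edge G)) (eg x) >].

Definition is_cluster (C : I) : set (config G) :=
  [set w | animal s a C /\ fits (open_darts w) C].

Definition is_dual_cluster (C : I) : set (config G) :=
  [set w | animal face a C /\ fits (fun x => ~~ open_darts w x) C].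

Lemma open_darts_flip w x : open_darts w (a x) = open_darts w x.
Proof. by rewrite /open_darts (_ : eg (a x) = eg x) //; apply/egP; right. Qed.

Lemma is_clusterE C : animal s a C -> is_cluster C = pattern eg C.2 (C.1 `\` C.2)%fset.
Proof.
move=> aC; have [_ _ sC _ _] := aC; apply/seteqP; split => w /= [].
  move=> _ fC; split => x; last first.
    rewrite inE => /andP[xE xV]; have := fC x xV; rewrite (negbTE xE).
    by move=> /asboolPn.
  by move=> xE; have := fC x (sC _ xE); rewrite xE => /asboolP.
move=> oE cE; split => // x xV; apply/asboolP/idP => [|/oE //].
by move=> wx; apply: contraT => xE; exfalso; apply: (cE x) => //; rewrite inE xE.
Qed.

Lemma is_dual_clusterE C : animal face a C ->
  is_dual_cluster C = pattern eg (C.1 `\` C.2)%fset C.2.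
Proof.
move=> aC; have [_ _ sC _ _] := aC; apply/seteqP; split => w /= [].
  move=> _ fC; split => x.
    rewrite inE => /andP[xE xV]; have := fC x xV; rewrite (negbTE xE).
    by move=> /negbFE/asboolP.
  by move=> xE; have := fC x (sC _ xE); rewrite xE => /asboolPn.
move=> oE cE; split => // x xV; have [xE|xE] := boolP (x \in C.2).
  by apply/asboolPn; exact: cE.
by apply/negbTE; rewrite negbK; apply/asboolP/oE; rewrite inE xE.
Qed.

Let measurable_cond (Q : Prop) (A : set (config G)) :
  (Q -> measurable A) -> measurable [set w | Q /\ A w].
Proof.
move=> mA; have [q|nq] := pselect Q.
  by rewrite (_ : [set _ | _] = A); [exact: mA|apply/seteqP; split => w; [case|split]].
by rewrite (_ : [set _ | _] = set0) //; apply/seteqP; split => w //= -[].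
Qed.

Lemma measurable_is_cluster C : measurable (is_cluster C).
Proof.
rewrite (_ : is_cluster C = [set w | animal s a C /\ is_cluster C w]); last first.
  by apply/seteqP; split => w; [move=> h; split => //; case: h|case].
by apply: measurable_cond => aC; rewrite is_clusterE //; exact: measurable_pattern.
Qed.

Lemma measurable_is_dual_cluster C : measurable (is_dual_cluster C).
Proof.
rewrite (_ : is_dual_cluster C = [set w | animal face a C /\ is_dual_cluster C w]); last first.
  by apply/seteqP; split => w; [move=> h; split => //; case: h|case].
by apply: measurable_cond => aC; rewrite is_dual_clusterE //; exact: measurable_pattern.
Qed.

Let P_cond (Q : Prop) (A : set (config G)) : P [set w | Q /\ A w] = `[<Q>]%:R%:E * P A.
Proof.
case: asboolP => [q|nq].
  by rewrite mul1e; congr (P _); apply/seteqP; split => w; [case|split].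
by rewrite mul0e (_ : [set _ | _] = set0) ?measure0 //; apply/seteqP; split => w //= -[].
Qed.

Definition joint (K L : I) : set (config G) :=
  is_cluster K `&` [set w | surrounds s a K L /\ is_dual_cluster L w].

Section Invariance.
Variables (g g' : T -> T).
Hypothesis gK : cancel g g'.
Hypothesis g'K : cancel g' g.
Hypothesis gs : forall x, g (s x) = s (g x).
Hypothesis ga : forall x, g (a x) = a (g x).

Let g's x : g' (s x) = s (g' x). Proof. by rewrite -{1}(g'K x) -gs gK. Qed.
Let g'a x : g' (a x) = a (g' x). Proof. by rewrite -{1}(g'K x) -ga gK. Qed.

Let relabelD (X Y : {fset T}) : ([fset g x | x in X] `\` [fset g x | x in Y] =
  [fset g x | x in X `\` Y])%fset.
Proof. by apply/fsetP => x; rewrite !inE !(mem_relabel gK g'K) !inE. Qed.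

Let relabelU (X Y : {fset T}) : ([fset g x | x in X] `|` [fset g x | x in Y] =
  [fset g x | x in X `|` Y])%fset.
Proof. by apply/fsetP => x; rewrite !inE !(mem_relabel gK g'K) !inE. Qed.

Let animal_relabelP C : animal s a (relabel g C) <-> animal s a C.
Proof.
split; last exact: (animal_relabel gK g'K).
by move=> /(animal_relabel g'K gK g's g'a); rewrite (relabelK gK).
Qed.

Let animal_face_relabelP C : animal face a (relabel g C) <-> animal face a C.
Proof.
have gf x : g (face x) = face (g x) by rewrite /= gs ga.
have g'f x : g' (face x) = face (g' x) by rewrite /= g's g'a.
split; last exact: (animal_relabel gK g'K).
by move=> /(animal_relabel g'K gK g'f g'a); rewrite (relabelK gK).
Qed.

Let surrounds_relabelP K L : surrounds s a (relabel g K) (relabel g L) <-> surrounds s a K L.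
Proof.
split; last exact: (surrounds_relabel gK g'K).
by move=> /(surrounds_relabel g'K gK g's g'a); rewrite !(relabelK gK).
Qed.

Lemma is_cluster_relabel C : P (is_cluster (relabel g C)) = P (is_cluster C).
Proof.
have [aC|naC] := pselect (animal s a C); last first.
  by congr (P _); apply/seteqP; split => w [] // /animal_relabelP.
rewrite !is_clusterE //; last exact/animal_relabelP.
by rewrite /= relabelD (pattern_relabel bP egP _ _ gK g'K ga).
Qed.

Lemma joint_relabel K L : P (joint (relabel g K) (relabel g L)) = P (joint K L).
Proof.
have [h|nh] := pselect [/\ animal s a K, animal face a L & surrounds s a K L]; last first.
  congr (P _); apply/seteqP; split => w [[aK' _] [sKL [aL' _]]]; exfalso; apply: nh.
    by split; [exact/animal_relabelP|exact/animal_face_relabelP|exact/surrounds_relabelP].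
  by split.
have jE K' L' : animal s a K' -> animal face a L' -> surrounds s a K' L' ->
    joint K' L' = pattern eg (K'.2 `|` (L'.1 `\` L'.2))%fset ((K'.1 `\` K'.2) `|` L'.2)%fset.
  move=> aK' aL' sKL; rewrite /joint is_clusterE // is_dual_clusterE //.
  apply/seteqP; split => w /=.
    move=> [[h1 h2] [_ [h3 h4]]]; split => x; rewrite in_fsetU => /orP[] xX.
    - exact: h1. - exact: h3. - exact: h2. - exact: h4.
  move=> [h1 h2]; split; split => //.
  - by move=> x xX; apply: h1; rewrite in_fsetU xX.
  - by move=> x xX; apply: h2; rewrite in_fsetU xX.
  - by split => x xX; [apply: h1|apply: h2]; rewrite in_fsetU xX orbT.
case: h => h1 h2 h3; rewrite !jE //; last 3 first.
- exact/animal_relabelP. - exact/animal_face_relabelP. - exact/surrounds_relabelP.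
by rewrite /= !relabelD !relabelU (pattern_relabel bP egP _ _ gK g'K ga).
Qed.

End Invariance.

Variable N : set (config G).
Hypothesis mN : measurable N.
Hypothesis PN : P N = 0.
Hypothesis finN : forall w x, ~ N w -> finite_set [set y | conn s a (open_darts w) x y].

Let clusterP w x (nw : ~ N w) :=
  cluster_animal m_gt0 (map_s_iter H) aK (open_darts_flip w) (finN x nw).

Lemma sum_cluster d : \esum_(C in [set: I]) ((d \in C.1)%:R%:E * P (is_cluster C)) = 1.
Proof.
transitivity (1%:R%:E * P setT); last by rewrite probability_setT mul1e.
rewrite -(@counting _ _ _ P I (fun C => [set w | d \in C.1 /\ is_cluster C w]) setT N 1) //.
- by apply: eq_esum => C _; rewrite setTI P_cond asboolb.
- by move=> C; apply: measurable_cond => _; exact: measurable_is_cluster.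
move=> w _ nw; exists [fset cluster s a (open_darts w) d]%fset; split; first exact: cardfs1.
have [aC fC mC _] := clusterP d nw; move=> C; rewrite inE; split => [[dC [aC' fC']]|/eqP->].
  by apply/eqP; exact: animal_cluster.
by split => //; rewrite mC; apply/asboolP; exact: conn_refl.
Qed.

Lemma sum_open_cluster d :
  \esum_(C in [set: I]) ((d \in C.2)%:R%:E * P (is_cluster C)) = p%:E.
Proof.
rewrite -(bP.1 (eg d)) -[RHS]mul1e -[1]/(1%:R%:E).
rewrite -(@counting _ _ _ P I (fun C => [set w | d \in C.2 /\ is_cluster C w])
  (open_edge (eg d)) N 1) //.
- apply: eq_esum => C _; transitivity (P [set w | d \in C.2 /\ is_cluster C w]).
    by rewrite P_cond asboolb.
  congr (P _); apply/seteqP; split => w; last by case.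
  move=> [dC [aC fC]]; split => //; have [_ _ sC _ _] := aC.
  by apply/asboolP; rewrite -/(open_darts w d) fC //; exact: sC.
- exact: measurable_open_edge.
- by move=> C; apply: measurable_cond => _; exact: measurable_is_cluster.
move=> w wd nw; exists [fset cluster s a (open_darts w) d]%fset; split; first exact: cardfs1.
have [aC fC mC mC2] := clusterP d nw; move=> C; rewrite inE; split => [[dC [aC' fC']]|/eqP->].
  by apply/eqP; apply: animal_cluster => //; case: aC' => _ _ sC _ _; exact: sC.
split => //; rewrite mC2; apply/andP; split; apply/asboolP => //; exact: conn_refl.
Qed.

(** The cycle rank of [C]; for animals the truncated subtraction is exact by [inner_countE]. *)
Definition inner_count (C : I) : nat := (#|` edge_reps a C.2| + 1 - #|` vertex_reps m s C.1|)%N.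

Lemma sum_joint_inner K :
  \esum_(L in [set: I]) P (joint K L) = (inner_count K)%:R%:E * P (is_cluster K).
Proof.
rewrite -(@counting _ _ _ P I (fun L => [set w | surrounds s a K L /\ is_dual_cluster L w])
  (is_cluster K) N (inner_count K)) //; first exact: measurable_is_cluster.
  by move=> L; apply: measurable_cond => _; exact: measurable_is_dual_cluster.
move=> w [aK' fK] nw; exists (inners s a (open_darts w) K); split.
  by rewrite /inner_count -(card_inners H (open_darts_flip w) (fun x => finN x nw) aK' fK) addnK.
move=> L; split => [[sKL [aL fL]]|/(innersP H)[aL fL sKL]]; last by split.
by apply/(innersP H).
Qed.

Lemma sum_joint_outer L : \esum_(K in [set: I]) P (joint K L) = P (is_dual_cluster L).
Proof.
rewrite -[RHS]mul1e -[1]/(1%:R%:E).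
rewrite -(@counting _ _ _ P I (fun K => [set w | surrounds s a K L /\ is_cluster K w])
  (is_dual_cluster L) N 1) //.
- apply: eq_esum => K _; congr (P _); apply/seteqP; split => w; rewrite /joint /=; tauto.
- exact: measurable_is_dual_cluster.
- by move=> K; apply: measurable_cond => _; exact: measurable_is_cluster.
move=> w [aL fL] nw.
have [K KP] := surrounds_unique H (open_darts_flip w) (fun x => finN x nw) aL fL.
exists [fset K]%fset; split; first exact: cardfs1.
move=> K'; rewrite inE -(rwP eqP) -KP /is_cluster /=; tauto.
Qed.

Definition inv_card (C : I) : R := (#|` C.1|%:R^-1)%R.

Lemma inv_card_ge0 C : (0 <= inv_card C)%R.
Proof. by rewrite invr_ge0. Qed.

(* Since [#|C.1|] is [m] times the number of vertices of [C], these are the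
   expectations of the inverse number of vertices of the primal and dual
   clusters at [d], divided by [m] (infinite clusters count for 0). *)
Definition density d : \bar R :=
  \esum_(C in [set: I]) ((d \in C.1)%:R%:E * ((inv_card C)%:E * P (is_cluster C))).

Definition dual_density d : \bar R :=
  \esum_(C in [set: I]) ((d \in C.1)%:R%:E * ((inv_card C)%:E * P (is_dual_cluster C))).

Lemma mul_card_inv_card (f : T -> T) C (x : \bar R) : (~ animal f a C -> x = 0) ->
  #|` C.1|%:R%:E * ((inv_card C)%:E * x) = x.
Proof.
move=> x0; have [aC|/x0->] := pselect (animal f a C); last by rewrite !mule0.
have [[d dC] _ _ _ _] := aC.
rewrite muleA -EFinM divff ?mul1e // pnatr_eq0 -lt0n cardfs_gt0.
by apply/fset0Pn; exists d.
Qed.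

Let nneg_b (b : bool) : (0 <= b%:R :> R)%R. Proof. by case: b. Qed.

Ltac nneg := repeat first [exact: nneg_b | exact: inv_card_ge0 | exact: measure_ge0
  | exact: ler0n | rewrite lee_fin | apply: mule_ge0 | (apply: esum_ge0 => ? _) | done].

(** Every dart of a cluster sends mass [inv_card C] to each dart of [C.2]. A dart then receives 1
    exactly when it is open, so the expected mass received is [p]. *)
Lemma sum_edge_density d :
  \esum_(C in [set: I]) (#|` C.2|%:R%:E * ((d \in C.1)%:R%:E *
    ((inv_card C)%:E * P (is_cluster C)))) = p%:E.
Proof.
pose F x y := \esum_(C in [set: I]) ((y \in C.2)%:R%:E * ((x \in C.1)%:R%:E *
    ((inv_card C)%:E * P (is_cluster C)))).
transitivity (\esum_(y in [set: T]) F d y).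
  rewrite esum_swap; last by move=> *; nneg.
  by apply: eq_esum => C _; rewrite esum_fset_const //; nneg.
rewrite (mass_transport (H := H)); last first.
  move=> d1 d2 x y.
  have gK := automK H d1 d2; have g'K := automK H d2 d1.
  rewrite /F (esum_bij _ (relabelK gK) (relabelK g'K)); apply: eq_esum => C _.
  rewrite (is_cluster_relabel gK g'K (autom_s H d1 d2) (autom_a H d1 d2)).
  by rewrite /inv_card /= !(mem_relabel gK g'K) !gK (card_relabel gK).
rewrite esum_swap; last by move=> *; nneg.
rewrite -(sum_open_cluster d); apply: eq_esum => C _.
rewrite esumZ //; last by move=> *; nneg.
rewrite esum_fset_const; last by nneg.
rewrite (mul_card_inv_card (f := s)) // => naC; rewrite (_ : is_cluster C = set0) ?measure0 //.
by apply/seteqP; split => w [].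
Qed.

(* Mass is sent from each primal cluster to the dual clusters it surrounds. *)
Lemma dual_density_inner d : dual_density d =
  \esum_(C in [set: I]) ((d \in C.1)%:R%:E *
    ((inv_card C)%:E * ((inner_count C)%:R%:E * P (is_cluster C)))).
Proof.
(* A dart of [K] sends the product of the two inverse sizes to each dart of a surrounded [L]. A dart
   of [L] receives 1/|L| in total; a dart of [K] sends out 1/|K| for each such [L]. *)
pose F x y := \esum_(K in [set: I]) \esum_(L in [set: I]) ((y \in L.1)%:R%:E * ((x \in K.1)%:R%:E *
    ((inv_card K)%:E * ((inv_card L)%:E * P (joint K L))))).
have joint0 K L : ~ (animal s a K /\ animal face a L) -> P (joint K L) = 0.
  move=> h; rewrite (_ : joint K L = set0) ?measure0 //.
  by apply/seteqP; split => w // [[? _] [_ [? _]]]; apply: h.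
transitivity (\esum_(x in [set: T]) F x d).
  rewrite /F esum_swap; last by move=> *; nneg.
  transitivity (\esum_(K in [set: I]) \esum_(L in [set: I])
      ((d \in L.1)%:R%:E * ((inv_card L)%:E * P (joint K L)))); last first.
    apply: eq_esum => K _; rewrite esum_swap; last by move=> *; nneg.
    apply: eq_esum => L _; rewrite esumZ //; last by move=> *; nneg.
    rewrite esum_fset_const; last by nneg.
    by rewrite (mul_card_inv_card (f := s)) // => naK; rewrite joint0 ?mule0 // => -[].
  rewrite esum_swap; last by move=> *; nneg.
  apply: eq_esum => L _; rewrite esumZ //; last by move=> *; nneg.
  rewrite esumZ //; last by move=> *; nneg.
  by rewrite sum_joint_outer.
rewrite -(mass_transport (H := H)); last first.
  move=> d1 d2 x y.
  have gK := automK H d1 d2; have g'K := automK H d2 d1.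
  rewrite /F (esum_bij _ (relabelK gK) (relabelK g'K)); apply: eq_esum => K _.
  rewrite (esum_bij _ (relabelK gK) (relabelK g'K)); apply: eq_esum => L _.
  rewrite (joint_relabel gK g'K (autom_s H d1 d2) (autom_a H d1 d2)).
  by rewrite /inv_card /= !(mem_relabel gK g'K) !gK !(card_relabel gK).
transitivity (\esum_(K in [set: I]) \esum_(L in [set: I])
    ((d \in K.1)%:R%:E * ((inv_card K)%:E * P (joint K L)))).
  rewrite /F esum_swap; last by move=> *; nneg.
  apply: eq_esum => K _; rewrite esum_swap; last by move=> *; nneg.
  apply: eq_esum => L _; rewrite esum_fset_const; last by nneg.
  rewrite muleCA; congr (_ * _); rewrite muleCA; congr (_ * _).
  by rewrite (mul_card_inv_card (f := face)) // => naL; rewrite joint0 // => -[].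
apply: eq_esum => K _; rewrite esumZ //; last by move=> *; nneg.
rewrite esumZ //; last by move=> *; nneg.
by rewrite sum_joint_inner.
Qed.

(** Obtained from [card_inners] for the configuration whose open edges are exactly those of [C]: its
    clusters are [C] and single vertices, all finite. *)
Lemma inner_countE C : animal s a C ->
  (inner_count C + #|` vertex_reps m s C.1| = #|` edge_reps a C.2| + 1)%N.
Proof.
move=> aC; have [_ sC subC aC2 _] := aC.
have fin x : finite_set [set y | conn s a (fun z => z \in C.2) x y].
  have [xC|xC] := boolP (x \in C.1).
    apply: sub_finite_set (finite_fset C.1) => y /=.
    by elim=> [//|u _|u _ _ uC]; [rewrite sC|apply: subC; rewrite aC2].
  apply: sub_finite_set (finite_seq (traject s x m)) => y /= xy.
  suff [k km ->] : exists2 k, (k < m)%N & y = iter k s x by apply/trajectP; exists k.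
  elim: xy => [|u _ [k km ->]|u _ [k km ->] uC]; first by exists 0%N.
    have [e|ne] := eqVneq k.+1 m; last by exists k.+1; [lia|].
    by exists 0%N; rewrite //= -iterS e (map_s_iter H).
  exfalso; move: xC => /negP; apply; move/subC: uC.
  by elim: k {km} => // k IH; rewrite iterS sC.
have fC : fits (fun z => z \in C.2) C by [].
have := card_inners H aC2 fin aC fC; rewrite /inner_count => <-.
by rewrite addnK.
Qed.

(** Both sides are sums over the possible clusters of [d], and agree term by term. With v vertices
    and e edges the term identity is (e + 1 - v)/(mv) + 1/m = 1/(mv) + e/(mv). *)
Lemma density_identity d : dual_density d + (m%:R^-1)%:E = density d + (p / 2)%:E.
Proof.
rewrite dual_density_inner.
have -> : (m%:R^-1)%:E = \esum_(C in [set: I])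
    ((m%:R^-1)%:E * ((d \in C.1)%:R%:E * P (is_cluster C))).
  rewrite esumZ; [by rewrite sum_cluster mule1|by rewrite invr_ge0|by move=> *; nneg].
have -> : (p / 2)%:E = \esum_(C in [set: I]) ((2^-1)%:E * (#|` C.2|%:R%:E * ((d \in C.1)%:R%:E *
    ((inv_card C)%:E * P (is_cluster C))))).
  rewrite esumZ; [|by rewrite invr_ge0|by move=> *; nneg].
  by rewrite sum_edge_density -EFinM mulrC.
rewrite /density -!esumD; try by (move=> *; nneg; rewrite invr_ge0).
apply: eq_esum => C _; have [aC|naC] := pselect (animal s a C); last first.
  rewrite (_ : is_cluster C = set0) ?measure0 ?mule0 //.
  by apply/seteqP; split => w [].
have [dC|_] := boolP (d \in C.1); last by rewrite !mul0e !mule0.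
rewrite -(fineK (fin_num_measure P _ (measurable_is_cluster C))).
move: (fine _) => r; rewrite -!EFinM -!EFinD; congr (_%:E).
have [_ sC _ aC2 _] := aC.
have := inner_countE aC; rewrite /inv_card (card_vertex_reps H sC) (card_edge_reps H aC2).
set c := inner_count C; set v := #|` vertex_reps _ _ _|; set e := #|` edge_reps _ _|.
move=> cve.
have v0 : (0 < v)%N.
  have : (0 < m * v)%N by rewrite -(card_vertex_reps H sC) cardfs_gt0; apply/fset0Pn; exists d.
  by rewrite muln_gt0 => /andP[].
have {}cve : (c%:R = e%:R + 1 - v%:R :> R)%R.
  by apply/eqP; rewrite eq_sym subr_eq -natrD cve natrD.
rewrite cve !natrM; field.
by rewrite !pnatr_eq0 -!lt0n m_gt0 v0.
Qed.

End Identity.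

(** * Densities as sums of weights over animals *)

Section AnimalSums.
Variables (R : realType) (G : graph) (p : R) (P : probability (config G) R).
Hypothesis bP : bernoulli_percolation p P.
Variables (m : nat) (T : countType) (s a : T -> T) (eg : T -> edge G).
Hypothesis H : regular_map m s a.
Hypothesis egP : forall x y, eg x = eg y <-> x = y \/ x = a y.

Local Notation face := (s \o a).
Local Notation I := ({fset T} * {fset T})%type.

Definition animal_weight (q : R) (C : I) : R :=
  (inv_card R C * (q ^+ edge_count eg C.2 * (1 - q) ^+ edge_count eg (C.1 `\` C.2)%fset))%R.

Definition animals_at (d : T) : set I := [set C | animal s a C /\ d \in C.1].

Let disj f C x y : animal f a C -> x \in C.2 -> y \in (C.1 `\` C.2)%fset -> eg x <> eg y.
Proof.
move=> [_ _ _ aC _]; rewrite inE => xC /andP[/negP yC _] /egP e; apply: yC.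
by case: e xC => ->; rewrite ?aC.
Qed.

Lemma is_cluster_prob C : animal s a C -> P (is_cluster s a eg C) =
  (p ^+ edge_count eg C.2 * (1 - p) ^+ edge_count eg (C.1 `\` C.2)%fset)%:E.
Proof.
move=> aC; rewrite is_clusterE // (pattern_prob bP) // => x y; exact: disj aC.
Qed.

Lemma is_dual_cluster_prob C : animal face a C -> P (is_dual_cluster s a eg C) =
  ((1 - p) ^+ edge_count eg C.2 * p ^+ edge_count eg (C.1 `\` C.2)%fset)%:E.
Proof.
move=> aC; rewrite is_dual_clusterE // (pattern_prob bP) 1?mulrC // => x y xC yC.
exact/nesym/(disj aC).
Qed.

Let is_cluster0 C : ~ animal s a C -> P (is_cluster s a eg C) = 0%E.
Proof.
move=> naC; rewrite (_ : is_cluster s a eg C = set0) ?measure0 //.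
by apply/seteqP; split => w [].
Qed.

Let is_dual_cluster0 C : ~ animal face a C -> P (is_dual_cluster s a eg C) = 0%E.
Proof.
move=> naC; rewrite (_ : is_dual_cluster s a eg C = set0) ?measure0 //.
by apply/seteqP; split => w [].
Qed.

Lemma densityE d :
  density P s a eg d = \esum_(C in animals_at d) (animal_weight p C)%:E.
Proof.
rewrite /density [RHS]esum_mkcond; apply: eq_esum => C _; rewrite /animals_at.
case: ifPn => [|nC].
  by rewrite inE => -[aC ->]; rewrite mul1e is_cluster_prob.
have [dC|_] := boolP (d \in C.1); last by rewrite mul0e.
rewrite is_cluster0 ?mule0 // => aC; move: nC; rewrite notin_setE; exact.
Qed.

(** The duality fixing [d] carries primal animals at [d] to dual ones, and the edges of a dual
    cluster are closed, hence the parameter [1 - p]. *)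
Lemma dual_densityE d :
  dual_density P s a eg d = \esum_(C in animals_at d) (animal_weight (1 - p) C)%:E.
Proof.
pose g := dualize H d.
have gK : cancel g g := dualizeK H d.
have gs x : g (s x) = face (g x) := dualize_s H d x.
have ga x : g (a x) = a (g x) := dualize_a H d x.
have gf x : g (face x) = s (g x) by rewrite -[x in LHS]gK -gs gK.
have aP C : animal face a (relabel g C) <-> animal s a C.
  split; last exact: (animal_relabel gK gK).
  by move=> /(animal_relabel gK gK gf ga); rewrite (relabelK gK).
rewrite /dual_density (esum_bij _ (relabelK gK) (relabelK gK)) [RHS]esum_mkcond.
have gD X Y : ([fset g x | x in X] `\` [fset g x | x in Y] = [fset g x | x in X `\` Y])%fset.
  by apply/fsetP => x; rewrite !inE !(mem_relabel gK gK) !inE.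
apply: eq_esum => C _; rewrite /animals_at /= (mem_relabel gK gK).
have -> : g d = d := dualizeE H d.
case: ifPn => [|nC].
  rewrite inE => -[aC ->]; rewrite mul1e is_dual_cluster_prob; last exact/aP.
  rewrite /= gD !(edge_count_relabel egP _ gK ga) /animal_weight /inv_card /= (card_relabel gK).
  by rewrite subKr.
have [dC|_] := boolP (d \in C.1); last by rewrite mul0e.
rewrite is_dual_cluster0 ?mule0 // => /aP aC; move: nC; rewrite notin_setE; exact.
Qed.

Hypothesis p01 : 0 <= p <= 1.

Lemma animal_weight_ge0 (q : R) C : 0 <= q <= 1 -> 0 <= animal_weight q C.
Proof.
move=> /andP[q0 q1]; rewrite /animal_weight mulr_ge0 ?inv_card_ge0 // mulr_ge0 // exprn_ge0 //.
by rewrite subr_ge0.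
Qed.

Variable N : set (config G).
Hypothesis mN : measurable N.
Hypothesis PN : P N = 0%E.
Hypothesis finN : forall w x, ~ N w ->
  finite_set [set y | conn s a (open_darts eg w) x y].

(** The primal density is at most 1, being bounded by the total probability of the clusters of [d];
    the identity then makes the dual density finite too. *)
Lemma animal_sums d : exists k k' : R,
  [/\ \esum_(C in animals_at d) (animal_weight p C)%:E = k%:E,
      \esum_(C in animals_at d) (animal_weight (1 - p) C)%:E = k'%:E &
      k' + m%:R^-1 = k + p / 2].
Proof.
have idt := density_identity bP H egP mN PN finN d.
rewrite -densityE -dual_densityE.
have k0 : (0 <= density P s a eg d)%E.
  by rewrite densityE; apply: esum_ge0 => C _; rewrite lee_fin animal_weight_ge0.
have k'0 : (0 <= dual_density P s a eg d)%E.
  rewrite dual_densityE; apply: esum_ge0 => C _; rewrite lee_fin animal_weight_ge0 //.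
  by case/andP: p01 => p0 p1; rewrite subr_ge0 p1 gerBl.
have k1 : (density P s a eg d <= 1)%E.
  rewrite -(sum_cluster H egP mN PN finN d) /density; apply: le_esum => C _.
  have [dC|_] := boolP (d \in C.1); last by rewrite !mul0e.
  rewrite !mul1e -[leRHS]mul1e; apply: lee_wpmul2r => //.
  rewrite lee_fin /inv_card invf_le1 ?ltr0n ?ler1n cardfs_gt0; by apply/fset0Pn; exists d.
have kfin : density P s a eg d \is a fin_num.
  by rewrite ge0_fin_numE //; apply: le_lt_trans k1 _; rewrite ltry.
move: idt; rewrite -(fineK kfin); set k := fine _.
case: (dual_density P s a eg d) k'0 => [k'| |] //= _.
by move=> [e]; exists k, k'.
Qed.

End AnimalSums.

(** * From animals to subgraphs *)

Section Subgraphs.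
Variables (m : nat) (G : graph) (T : countType) (s a : T -> T) (o : T -> G).
Hypothesis H : regular_map m s a.
Hypothesis o_s : forall t, o (s t) = o t.
Hypothesis o_orbit : forall t t', o t = o t' -> exists k, iter k s t = t'.
Hypothesis o_surj : forall x, exists t, o t = x.
Hypothesis o_adj : forall t, adj (o t) (o (a t)).
Hypothesis adj_o : forall x y, adj x y -> exists t, o t = x /\ o (a t) = y.
Hypothesis o_inj : forall t t', o t = o t' -> o (a t) = o (a t') -> t = t'.

Local Notation I := ({fset T} * {fset T})%type.
Let aK := map_aK H.

Lemma dart_edge_set t : [set o t; o (a t)] \in @edge_set G.
Proof. by apply/mem_set; exists (o t), (o (a t)); split. Qed.

Definition dart_edge (t : T) : edge G := exist _ [set o t; o (a t)] (dart_edge_set t).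

Lemma endpoints_dart t : endpoints (dart_edge t) = [set o t; o (a t)].
Proof. by []. Qed.

Lemma pair_eq (x y x' y' : G) : [set x; y] = [set x'; y'] ->
  (x = x' /\ y = y') \/ (x = y' /\ y = x').
Proof.
move=> e.
have : [set x'; y'] x by rewrite -e; left.
have : [set x'; y'] y by rewrite -e; right.
have : [set x; y] x' by rewrite e; left.
have : [set x; y] y' by rewrite e; right.
by case=> ?; case=> ?; case=> ?; case=> ?;
  solve [left; split; congruence|right; split; congruence].
Qed.

Lemma dart_edgeP x y : dart_edge x = dart_edge y <-> x = y \/ x = a y.
Proof.
split => [/(congr1 val)/=/pair_eq[] [e1 e2]|[->//|->]].
- by left; exact: o_inj.
- by right; apply: o_inj; rewrite ?aK.
- by apply/val_inj; rewrite /= aK setUC.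
Qed.

Lemma edge_dart (e : edge G) : exists t, e = dart_edge t.
Proof.
have [x [y [xy exy]]] := set_mem (valP e); have [t [tx ty]] := adj_o xy.
by exists t; apply/val_inj; rewrite /= tx ty.
Qed.

Lemma joined_dart (F : set (edge G)) t y : joined F (o t) y ->
  exists t', [/\ o t' = o t, o (a t') = y & F (dart_edge t')].
Proof.
move=> /asboolP[e Fe]; have [t' e'] := edge_dart e.
rewrite {}e' in Fe *; rewrite endpoints_dart => /pair_eq[] [e1 e2].
  by exists t'.
exists (a t'); rewrite aK; split => //.
by rewrite (_ : dart_edge (a t') = dart_edge t') //; apply/dart_edgeP; right.
Qed.

Lemma iter_o k t : o (iter k s t) = o t.
Proof. by elim: k => // k IH; rewrite iterS o_s. Qed.

Lemma conn_reachable (F : set (edge G)) t t' :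
  reachable F (o t) (o t') <-> conn s a (fun x => `[< F (dart_edge x) >]) t t'.
Proof.
split=> [[p [pp lp]]|].
  elim: p t pp lp => [|y p IH] t /= pp lp.
    by have [k <-] := o_orbit lp; exact: conn_iter.
  move: pp => /andP[ty pp]; have [u [u1 u2 uF]] := joined_dart ty.
  have [k ku] := o_orbit (esym u1).
  apply: (@conn_trans _ _ _ _ (a u)); last by apply: IH; rewrite u2.
  apply: conn_flip; last exact/asboolP.
  by rewrite -ku; exact: conn_iter.
elim=> [|u _ [p [pp lp]]|u _ [p [pp lp]] /asboolP uF]; first by exists [::].
  by exists p; rewrite o_s.
exists (rcons p (o (a u))); rewrite rcons_path last_rcons pp lp /=; split => //.
by apply/asboolP; exists (dart_edge u).
Qed.

Lemma finite_preimage_o (B : set G) : finite_set B <-> finite_set (o @^-1` B).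
Proof.
split=> fB.
  have m0 : (0 < m)%N := ltnW (map_m H).
  pose pick (x : G) : T := sval (cid (o_surj x)).
  have pickP x : o (pick x) = x by exact: svalP (cid (o_surj x)).
  have fin : finite_set ((fun xk : G * nat => iter xk.2 s (pick xk.1)) @` (B `*` `I_m)).
    by apply: finite_image; apply: finite_setX => //; exact: finite_II.
  apply: sub_finite_set fin => t /= tB.
  have [k kt] := o_orbit (pickP (o t)).
  exists (o t, (k %% m)%N); first by split => //=; rewrite ltn_pmod.
  rewrite /= -[RHS]kt [in RHS](divn_eq k m) addnC iterD; congr iter.
  by elim: (k %/ m)%N => // c IH; rewrite mulSn iterD -IH (map_s_iter H).
have -> : B = o @` (o @^-1` B).
  apply/seteqP; split => [x Bx|_ [t Bt <-]//]; have [t tx] := o_surj x.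
  by exists t; rewrite //= tx.
exact: finite_image.
Qed.

Definition to_subgraph (C : I) : subgraph G :=
  (o @` [set` C.1], dart_edge @` [set` C.2]).

Section Animal.
Variable C : I.
Hypothesis aC : animal s a C.

Let sC : forall x, (s x \in C.1) = (x \in C.1). Proof. by case: aC. Qed.
Let subC : {subset C.2 <= C.1}. Proof. by case: aC. Qed.
Let aC2 : forall x, (a x \in C.2) = (x \in C.2). Proof. by case: aC. Qed.

Lemma mem_to_subgraph1 t : (to_subgraph C).1 (o t) <-> t \in C.1.
Proof.
split=> [[u uC /esym/o_orbit[k ku]]|tC]; last by exists t.
move: uC; rewrite /= -ku; have -> // : (iter k s t \in C.1) = (t \in C.1).
by elim: (k) => // n IH; rewrite iterS sC.
Qed.

Lemma mem_to_subgraph2 t : (to_subgraph C).2 (dart_edge t) <-> t \in C.2.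
Proof.
split=> [[u uC /dart_edgeP e]|tC]; last by exists t.
by case: e uC => ->; rewrite //= aC2.
Qed.

Lemma to_subgraph_finite_connected d : d \in C.1 ->
  finite_connected_subgraphs (o d) (to_subgraph C).
Proof.
move=> dC; split.
- exact/mem_to_subgraph1.
- move=> e [t tC <-] x; rewrite endpoints_dart => -[->|->].
    exact/mem_to_subgraph1/subC.
  by apply/mem_to_subgraph1/subC; rewrite aC2.
- exact/finite_image/finite_fset.
- exact/finite_image/finite_fset.
- move=> x y; have [t <-] := o_surj x; have [u <-] := o_surj y.
  move=> /mem_to_subgraph1 tC /mem_to_subgraph1 uC; apply/conn_reachable.
  have [_ _ _ _ cC] := aC; apply: conn_sub (cC t u tC uC) => z _ zC.
  by apply/asboolP; exact/mem_to_subgraph2.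
Qed.

Lemma fin_card_to_subgraph1 : #|` C.1| = (m * fin_card (to_subgraph C).1)%N.
Proof.
rewrite (card_vertex_reps H sC) /fin_card fset_set_image; last exact: finite_fset.
rewrite set_fsetK; congr (m * _)%N.
rewrite (_ : vertex_reps m s C.1 = [fset vertex_rep m s x | x in C.1]%fset).
  apply: card_imfset_eq => x y _ _; split => [/(vertex_rep_eq H)[k <-]|/o_orbit[k <-]].
    by rewrite iter_o.
  by rewrite (vertex_rep_iter H).
apply/fsetP => x; rewrite !inE /=; apply/andP/imfsetP => [[xC /eqP e]|[y /= yC ->]].
  by exists x.
rewrite (vertex_repK H) eqxx; split => //.
have [k _ ->] := vertex_repP H y.
by elim: k => // k IH; rewrite iterS sC.
Qed.

Lemma fin_card_to_subgraph2 : fin_card (to_subgraph C).2 = edge_count dart_edge C.2.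
Proof.
rewrite /fin_card fset_set_image; last exact: finite_fset.
by rewrite set_fsetK.
Qed.

Lemma fin_card_boundary :
  fin_card (boundary (to_subgraph C)) = edge_count dart_edge (C.1 `\` C.2)%fset.
Proof.
rewrite /fin_card (_ : boundary _ = dart_edge @` [set` (C.1 `\` C.2)%fset]).
  by rewrite fset_set_image ?set_fsetK //; exact: finite_fset.
apply/seteqP; split => [e|e [t /= + <-]].
  have [t ->] := edge_dart e; move=> [[x xC tx] te].
  have tC : t \notin C.2 by apply/negP => /mem_to_subgraph2.
  move: tx; rewrite endpoints_dart => -[ex|ex]; rewrite {}ex in xC.
    by exists t => //=; rewrite inE tC; exact/mem_to_subgraph1.
  exists (a t) => /=; first by rewrite inE aC2 tC; exact/mem_to_subgraph1.
  by apply/dart_edgeP; right.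
rewrite inE => /andP[tC2 tC]; split; last by move=> /mem_to_subgraph2; exact/negP.
by exists (o t); [exact/mem_to_subgraph1|left].
Qed.

Lemma D_term_to_subgraph (R : realType) (p : R) :
  D_term p (to_subgraph C) =
  m%:R * (animal_weight dart_edge p C - animal_weight dart_edge (1 - p) C).
Proof.
have [[d dC] _ _ _ _] := aC.
have n0 : (0 < #|` C.1|)%N by rewrite cardfs_gt0; apply/fset0Pn; exists d.
rewrite /D_term fin_card_to_subgraph2 fin_card_boundary /animal_weight /inv_card.
move: n0; rewrite fin_card_to_subgraph1 muln_gt0 => /andP[m0 n0].
rewrite subKr -mulrBr natrM invfM mulrA mulrA divff ?mul1r // pnatr_eq0 -lt0n //.
Qed.

End Animal.

Lemma to_subgraph_bij d :
  set_bij (animals_at s a d) (finite_connected_subgraphs (o d)) to_subgraph.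
Proof.
split.
- by move=> C [aC dC]; exact: to_subgraph_finite_connected.
- move=> C C' /set_mem[aC dC] /set_mem[aC' dC'] e.
  case: C C' aC aC' e {dC dC'} => V E [V' E'] aC aC' e; congr (_, _); apply/fsetP => t.
    apply/idP/idP => h.
      by apply/(mem_to_subgraph1 aC'); rewrite -e; exact/(mem_to_subgraph1 aC).
    by apply/(mem_to_subgraph1 aC); rewrite e; exact/(mem_to_subgraph1 aC').
  apply/idP/idP => h.
    by apply/(mem_to_subgraph2 aC'); rewrite -e; exact/(mem_to_subgraph2 aC).
  by apply/(mem_to_subgraph2 aC); rewrite e; exact/(mem_to_subgraph2 aC').
- move=> [V E] [/= dV EV fV fE cV].
  have fC1 : finite_set [set t | V (o t)] by exact/finite_preimage_o.
  have subC : [set t | E (dart_edge t)] `<=` [set t | V (o t)].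
    by move=> t /EV; apply; left.
  have fC2 : finite_set [set t | E (dart_edge t)] by exact: sub_finite_set fC1.
  pose C : I := (fset_set [set t | V (o t)], fset_set [set t | E (dart_edge t)]).
  have C1 t : (t \in C.1) <-> V (o t) by rewrite in_fset_set // inE.
  have C2 t : (t \in C.2) <-> E (dart_edge t) by rewrite in_fset_set // inE.
  have ea t : dart_edge (a t) = dart_edge t by apply/dart_edgeP; right.
  have aC : animal s a C.
    split.
    + by exists d; exact/C1.
    + by move=> x; apply/idP/idP => /C1; rewrite ?o_s => h; apply/C1; rewrite ?o_s.
    + by move=> x /C2 h; exact/C1/subC.
    + by move=> x; apply/idP/idP => /C2; rewrite ?ea => h; apply/C2; rewrite ?ea.
    + move=> x y /C1 xV /C1 yV; have /conn_reachable := cV _ _ xV yV.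
      by apply: conn_sub => z _ /asboolP zE; exact/C2.
  exists C; first by split => //; exact/C1.
  congr (_, _); apply/seteqP; split => [x|x].
  + have [t <-] := o_surj x; by move=> /(mem_to_subgraph1 aC)/C1.
  + have [t <-] := o_surj x; by move=> xV; apply/(mem_to_subgraph1 aC)/C1.
  + have [t ->] := edge_dart x; by move=> /(mem_to_subgraph2 aC)/C2.
  + have [t ->] := edge_dart x; by move=> xV; apply/(mem_to_subgraph2 aC)/C2.
Qed.

(** Both weight sums are finite, so positive and negative parts may be recombined. The [m] darts per
    vertex cancel the denominator of 2/m. *)
Lemma D_animal_sums (R : realType) (p k k' : R) d :
  0 <= p <= 1 ->
  (\esum_(C in animals_at s a d) (animal_weight dart_edge p C)%:E = k%:E)%E ->
  (\esum_(C in animals_at s a d) (animal_weight dart_edge (1 - p) C)%:E = k'%:E)%E ->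
  D m (o d) p = 2 * (k - k').
Proof.
move=> p01 sk sk'.
have q01 : 0 <= 1 - p <= 1 by case/andP: p01 => p0 p1; rewrite subr_ge0 p1 gerBl.
have m0 : m%:R != 0 :> R by rewrite pnatr_eq0 -lt0n (ltnW (map_m H)).
pose F C := (m%:R%:E * (animal_weight dart_edge p C)%:E)%E.
pose F' C := (m%:R%:E * (animal_weight dart_edge (1 - p) C)%:E)%E.
have F0 C : (0 <= F C)%E by rewrite /F -EFinM lee_fin mulr_ge0 // animal_weight_ge0.
have F'0 C : (0 <= F' C)%E by rewrite /F' -EFinM lee_fin mulr_ge0 // animal_weight_ge0.
have sumF (q c : R) : 0 <= q <= 1 ->
    (\esum_(C in animals_at s a d) (animal_weight dart_edge q C)%:E = c%:E)%E ->
    (\esum_(C in animals_at s a d) (m%:R%:E * (animal_weight dart_edge q C)%:E) = (m%:R * c)%:E)%E.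
  move=> q01' sc; rewrite EFinM -sc esum_mkcond [in RHS]esum_mkcond -esumZ //.
    by apply: eq_esum => C _; case: ifP => // _; rewrite mule0.
  by move=> C; case: ifP => // _; rewrite lee_fin animal_weight_ge0.
have sF := sumF p k p01 sk; have sF' := sumF _ k' q01 sk'.
rewrite /D /real_sum.
rewrite !(@reindex_esum _ _ _ _ _ _ _ (to_subgraph_bij d)).
have e1 C : animals_at s a d C ->
    ((EFin \o D_term p) (to_subgraph C) = (F \- F') C)%E.
  by move=> [aC _]; rewrite /= D_term_to_subgraph // mulrBr EFinB !EFinM.
have sumF_fin (g : I -> \bar R) (c : R) : (forall C, 0 <= g C)%E ->
    (\esum_(C in animals_at s a d) g C = c%:E)%E -> summable (animals_at s a d) g.
  move=> g0 gc; rewrite /summable (eq_esum (b := g)) ?gc ?ltry // => C _.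
  by rewrite gee0_abs.
rewrite (eq_esum (b := (F \- F')^\+%E)); last by move=> C aC; rewrite !funeposE e1.
rewrite [X in (_ - X)%E](eq_esum (b := (F \- F')^\-%E)); last by move=> C aC; rewrite !funenegE e1.
rewrite esumB //; [|exact: sumF_fin sF|exact: sumF_fin sF'].
rewrite sF sF' /=; field; exact: m0.
Qed.

End Subgraphs.

(** * Critical percolation *)

Section NullSet.
Variables (m : nat) (G : graph) (T : countType) (s a : T -> T) (o : T -> G).
Hypothesis H : regular_map m s a.
Hypothesis o_s : forall t, o (s t) = o t.
Hypothesis o_orbit : forall t t', o t = o t' -> exists k, iter k s t = t'.
Hypothesis o_surj : forall x, exists t, o t = x.
Hypothesis o_adj : forall t, adj (o t) (o (a t)).
Hypothesis adj_o : forall x y, adj x y -> exists t, o t = x /\ o (a t) = y.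
Hypothesis o_inj : forall t t', o t = o t' -> o (a t) = o (a t') -> t = t'.

Local Notation I := ({fset T} * {fset T})%type.
Let aK := map_aK H.
Let m_gt0 : (0 < m)%N. Proof. exact: ltnW (map_m H). Qed.
Local Notation eg := (dart_edge o_adj).
Let egP := dart_edgeP H o_adj o_inj.

(** A countable union of cylinder events, which gives measurability of the infinite-component event
    by complement. *)
Definition finite_open (t : T) : set (config G) :=
  \bigcup_(C in [set: I]) [set w | t \in C.2 /\ is_cluster s a eg C w].

Lemma finite_openP t w : finite_open t w <->
  open_darts eg w t /\ finite_set [set y | conn s a (open_darts eg w) t y].
Proof.
split=> [[C _ [tC [aC fC]]]|[wt fin]].
  have [_ _ sC _ _] := aC; have tV := sC _ tC; split; first by rewrite fC.
  by apply: sub_finite_set (finite_fset C.1) => y /= /(animal_conn y aC fC tV).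
have [aC fC mC mC2] := cluster_animal m_gt0 (map_s_iter H) aK (open_darts_flip egP w) fin.
exists (cluster s a (open_darts eg w) t) => //; split => //.
by rewrite mC2 wt andbT; apply/asboolP; exact: conn_refl.
Qed.

Lemma measurable_finite_open t : measurable (finite_open t).
Proof.
apply: countable_bigcupT_measurable => [|C]; first exact: countableP.
have [tC|tC] := boolP (t \in C.2).
  rewrite (_ : [set _ | _] = is_cluster s a eg C); first exact: measurable_is_cluster.
  by apply/seteqP; split => w; [case|split].
by rewrite (_ : [set _ | _] = set0) //; apply/seteqP; split => w //= -[].
Qed.

Lemma in_infinite_componentE t :
  in_infinite_component (eg t) = open_edge (eg t) `\` finite_open t.
Proof.
have finE w x : finite_set [set y | reachable w (o x) y] <->
    finite_set [set y | conn s a (open_darts eg w) x y].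
  have -> : [set y | conn s a (open_darts eg w) x y] = o @^-1` [set y | reachable w (o x) y].
    apply/seteqP; split => y /=; have [h1 h2] := conn_reachable H o_s o_orbit o_adj adj_o o_inj w x y;
      [exact: h2|exact: h1].
  exact: (finite_preimage_o H o_orbit o_surj).
apply/seteqP; split => w [wt].
  move=> [x]; rewrite endpoints_dart => xt inf; split => // /finite_openP[_ fin].
  apply: inf; case: xt => ->; apply/finE => //.
  apply: sub_finite_set fin => y; apply: conn_trans.
  by apply: conn_flip; [exact: conn_refl|exact/asboolP].
move=> nfin; split => //; exists (o t); first by left.
move=> /finE fin; apply: nfin; apply/finite_openP; split => //; exact/asboolP.
Qed.

Variables (R : realType) (p : R) (P : probability (config G) R).
Hypothesis bP : bernoulli_percolation p P.

Lemma measurable_in_infinite_component (e : edge G) : measurable (in_infinite_component e).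
Proof.
have [t ->] := edge_dart o_adj adj_o e; rewrite in_infinite_componentE.
apply: measurableD; [exact: measurable_open_edge|exact: measurable_finite_open].
Qed.

Lemma finite_open_prob t : P (finite_open t) =
  (\esum_(C in [set: I]) ((t \in C.2)%:R%:E * P (is_cluster s a eg C)))%E.
Proof.
rewrite -[LHS]mul1e -[1%E]/(1%:R%:E).
rewrite -(@counting _ _ _ P I (fun C => [set w | t \in C.2 /\ is_cluster s a eg C w])
  (finite_open t) set0 1) //.
- apply: eq_esum => C _; rewrite setIidr; last by move=> w wC; exists C.
  have [tC|tC] := boolP (t \in C.2).
    by rewrite mul1e; congr (P _); apply/seteqP; split => w; [case|split].
  by rewrite mul0e (_ : [set _ | _] = set0) ?measure0 //; apply/seteqP; split => w //= -[].
- exact: measurable_finite_open.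
- move=> C; have [tC|tC] := boolP (t \in C.2).
    rewrite (_ : [set _ | _] = is_cluster s a eg C); first exact: measurable_is_cluster.
    by apply/seteqP; split => w; [case|split].
  by rewrite (_ : [set _ | _] = set0) //; apply/seteqP; split => w //= -[].
move=> w [C0 _ [tC0 [aC0 fC0]]] _; exists [fset C0]%fset; split; first exact: cardfs1.
have tV0 : t \in C0.1 by case: aC0 => _ _ sC _ _; exact: sC.
move=> C; rewrite inE; split => [[tC [aC fC]]|/eqP->]; last by [].
have tV : t \in C.1 by case: aC => _ _ sC _ _; exact: sC.
by apply/eqP; rewrite (animal_cluster aC fC tV) [RHS](animal_cluster aC0 fC0 tV0).
Qed.

Lemma finite_open_prob_eq t t' : P (finite_open t) = P (finite_open t').
Proof.
rewrite !finite_open_prob.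
have gK := automK H t' t; have g'K := automK H t t'.
rewrite (esum_bij _ (relabelK gK) (relabelK g'K)); apply: eq_esum => C _.
rewrite (is_cluster_relabel bP egP gK g'K (autom_s H t' t) (autom_a H t' t)).
by rewrite /= -{1}(automE H t' t) (mem_relabel gK g'K) gK.
Qed.

(** The probability in question is [p] minus that of [finite_open], and automorphisms make the
    latter the same at all darts. *)
Lemma null_infinite_component (e e' : edge G) :
  P (in_infinite_component e) = 0%E -> P (in_infinite_component e') = 0%E.
Proof.
have [t ->] := edge_dart o_adj adj_o e; have [t' ->] := edge_dart o_adj adj_o e'.
have PE u : P (in_infinite_component (eg u)) = (p%:E - P (finite_open u))%E.
  rewrite in_infinite_componentE.
  have -> : P (open_edge (eg u) `\` finite_open u) =
      (P (open_edge (eg u)) - P (open_edge (eg u) `&` finite_open u))%E.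
    apply: measureD; [exact: measurable_open_edge|exact: measurable_finite_open|].
    by apply: le_lt_trans (probability_le1 _ (measurable_open_edge _)) _; rewrite ltry.
  rewrite bP.1 setIidr // => w /finite_openP[/asboolP]//.
by rewrite !PE (finite_open_prob_eq t t').
Qed.

(** [N] is the union over all darts of the infinite-component events of their edges. Off [N], a
    vertex with an open edge has a finite cluster, and any other vertex is connected only to
    itself. *)
Lemma null_set_exists (e : edge G) : P (in_infinite_component e) = 0%E ->
  exists N : set (config G), [/\ measurable N, P N = 0%E &
    forall w x, ~ N w -> finite_set [set y | conn s a (open_darts eg w) x y]].
Proof.
move=> Pe0.
pose F n : set (config G) := if @choice.pickle_inv T n is Some t then in_infinite_component (eg t) else set0.
have mF n : measurable (F n).
  by rewrite /F; case: choice.pickle_inv => // t; exact: measurable_in_infinite_component.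
exists (\bigcup_n F n); split.
- exact: bigcupT_measurable.
- apply/negligibleP; first exact: bigcupT_measurable.
  apply: negligible_bigcup => n; apply/negligibleP => //.
  rewrite /F; case: choice.pickle_inv => [t|]; last exact: measure0.
  exact: null_infinite_component Pe0.
move=> w x nw.
have fin_open t : open_darts eg w t -> finite_set [set y | conn s a (open_darts eg w) t y].
  move=> wt; apply: contrapT => inf; apply: nw; exists (choice.pickle t) => //.
  rewrite /F choice.pickleK_inv in_infinite_componentE; split; first exact/asboolP.
  by move=> /finite_openP[].
have [[k wk]|nk] := pselect (exists k, open_darts eg w (iter k s x)).
  apply: sub_finite_set (fin_open _ wk) => y /=; apply: conn_trans.
  apply: (conn_sym m_gt0 (map_s_iter H) aK (open_darts_flip egP w)); exact: conn_iter.
apply: sub_finite_set (finite_seq (traject s x m)) => y /= xy.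
suff [k km ->] : exists2 k, (k < m)%N & y = iter k s x by apply/trajectP; exists k.
elim: xy => [|u _ [k km ->]|u _ [k km ->] uo]; first by exists 0%N.
  have [e'|ne] := eqVneq k.+1 m; last by exists k.+1; [lia|].
  by exists 0%N; rewrite //= -iterS e' (map_s_iter H).
by exfalso; apply: nk; exists k.
Qed.

End NullSet.

(** * Thinning by an independent configuration *)

Section Thinning.
Variables (R : realType) (G : graph).

Definition intersect_configs (w : config G * config G) : config G :=
  (w.1 : set (edge G)) `&` (w.2 : set (edge G)).

Lemma preimage_intersect_open (e : edge G) :
  intersect_configs @^-1` (open_edge e) = open_edge e `*` open_edge e.
Proof. by apply/seteqP; split => -[w w'] []. Qed.

Lemma measurable_intersect_configs : measurable_fun setT intersect_configs.
Proof.
apply: (@measurability _ _ _ (config G) setT intersect_configs (range (@open_edge G))) => [//|_ [_ [e _ <-] <-]].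
rewrite setTI preimage_intersect_open.
by apply: measurableX; exact: measurable_open_edge.
Qed.

Lemma in_infinite_component_mono (e : edge G) (w w' : set (edge G)) : w `<=` w' ->
  in_infinite_component e w -> in_infinite_component e w'.
Proof.
move=> ww' [we [x ex inf]]; split; first exact: ww'.
exists x => // fin; apply: inf; apply: sub_finite_set fin => y [p [pp lp]].
exists p; split => //; apply: sub_path pp => u u' /asboolP[f wf fu].
by apply/asboolP; exists f => //; exact: ww'.
Qed.

(** The given measures for different parameters are not coupled, so a new measure is built: the law
    of the intersection of two independent configurations. *)
Lemma thinning (p q : R) (P Q : probability (config G) R) (e : edge G) :
  bernoulli_percolation p P -> bernoulli_percolation q Q ->
  measurable (in_infinite_component e : set (config G)) ->
  P (in_infinite_component e) = 0%E ->
  exists P' : probability (config G) R,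
    bernoulli_percolation (p * q) P' /\ P' (in_infinite_component e) = 0%E.
Proof.
move=> bP bQ mI PI.
pose X : {mfun (config G * config G)%type >-> config G} :=
  mfun_Sub (mem_set measurable_intersect_configs).
exists (distribution (P \x Q)%E X).
have prodE (A B : set (config G)) : measurable A -> measurable B ->
    (P \x Q)%E (A `*` B) = (P A * Q B)%E.
  by move=> mA mB; exact: product_measure1E.
have open1 f : distribution (P \x Q)%E X (open_edge f) = (p * q)%:E.
  rewrite /distribution /pushforward /= preimage_intersect_open.
  rewrite prodE; try exact: measurable_open_edge.
  by rewrite bP.1 bQ.1.
split; first split => // r ur.
  rewrite (eq_bigr (fun=> (p * q)%:E)); last by move=> f _; exact: open1.
  set B : set (config G) := \bigcap_(f in [set` r]) open_edge f.
  have eB : intersect_configs @^-1` B = B `*` B.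
    apply/seteqP; split => -[w w'] /=.
      by move=> h; split => f /h [].
    by move=> [h h'] f fr; split; [exact: h|exact: h'].
  transitivity ((P \x Q)%E (B `*` B)); first by rewrite -eB.
  have mr : measurable B.
    by apply: fin_bigcap_measurable => // f _; exact: measurable_open_edge.
  rewrite prodE // bP.2 // bQ.2 //.
  rewrite (eq_bigr (fun=> p%:E)); last by move=> f _; exact: bP.1.
  rewrite [X in (_ * X)%E](eq_bigr (fun=> q%:E)); last by move=> f _; exact: bQ.1.
  elim: (r) => [|f r' IH]; first by rewrite !big_nil mule1.
  by rewrite !big_cons -IH EFinM muleACA.
apply/eqP; rewrite eq_le measure_ge0 andbT /distribution /pushforward /=.
apply: (@le_trans _ _ ((P \x Q)%E (in_infinite_component e `*` setT))); last first.
  by rewrite prodE // PI mul0e.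
apply: le_measure; rewrite ?inE.
- rewrite -[X in measurable X]setTI.
  by apply: measurable_intersect_configs.
- exact: measurableX.
- move=> [w w'] h; split => //=; apply: in_infinite_component_mono h.
  by move=> f [].
Qed.

End Thinning.

(** At p = 1/2 the two weight sums coincide, so their relation in [animal_sums] reduces to 1/m =
    1/4. *)
Lemma D_critical_identity (R : realType) (m : nat) (G : graph) (v : G) (e : edge G)
    (p : R) (P : probability (config G) R) :
  (1 < m)%N -> regular_plane_tiling m G -> 0 <= p <= 1 ->
  bernoulli_percolation p P -> P (in_infinite_component e) = 0%E ->
  D m v p + p - 2 / m%:R = 0 /\ (p = 2^-1 -> m = 4%N).
Proof.
move=> m1 tG p01 bP PI.
have [T [s [a [org [H [orgs orgorb] orgsurj [orgadj adjorg] orginj]]]]] := tiling_regular_map m1 tG.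
have m0 : m%:R != 0 :> R by rewrite pnatr_eq0 -lt0n ltnW.
have [d <-] := orgsurj v.
have [N [mN PN finN]] := null_set_exists H orgs orgorb orgsurj orgadj adjorg orginj bP PI.
have [k [k' [sk sk' kk']]] := animal_sums bP H (dart_edgeP H orgadj orginj) p01 mN PN finN d.
split.
  rewrite (D_animal_sums H orgs orgorb orgsurj adjorg orginj p01 sk sk').
  have -> : k = k' + m%:R^-1 - p / 2 by rewrite kk' addrK.
  by field.
move=> p2; have kE : k = k'.
  apply/EFin_inj; rewrite -sk -sk' p2; congr esum; apply/funext => C.
  by congr (animal_weight _ _ _)%:E; lra.
move: kk'; rewrite kE p2 => /addrI mE.
apply/eqP; rewrite -(eqr_nat R) -[m%:R]invrK mE; apply/eqP; by field.
Qed.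

Theorem theorem7p1 (R : realType) (m : nat) (G : graph) (v : G) (e : edge G)
    (P : R -> probability (config G) R) :
  (5 <= m)%N ->
  regular_plane_tiling m G ->
  (forall p : R, 0 <= p <= 1 -> bernoulli_percolation p (P p)) ->
  critical_prob P e <= p_h R m v.
Proof.
move=> m5 tG bP; have m1 : (1 < m)%N by exact: leq_trans m5.
have mI : measurable (in_infinite_component e : set (config G)).
  have [T [s [a [org [H [orgs orgorb] orgsurj [orgadj adjorg] orginj]]]]] := tiling_regular_map m1 tG.
  exact: (measurable_in_infinite_component H orgs orgorb orgsurj orgadj adjorg orginj).
have null (p : R) : percolation_prob P e p = 0 -> P p (in_infinite_component e) = 0%E.
  rewrite /percolation_prob => f0.
  by rewrite -(fineK (fin_num_measure (P p) _ mI)) f0.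
have p_half (p : R) : 0 <= p <= 1 -> percolation_prob P e p = 0 -> p <= 2^-1.
  move=> p01 /null PI; rewrite leNgt; apply/negP => p2.
  have p0 : p != 0 by apply: lt0r_neq0; lra.
  (* The retention probability that brings [p] down to 1/2; it is at most 1 because [p] exceeds
     1/2. *)
  have q01 : 0 <= (2 * p)^-1 <= 1.
    rewrite invr_ge0 mulr_ge0 ?(andP p01).1 //= invf_le1; lra.
  have [Q [bQ QI]] := thinning (bP p p01) (bP _ q01) mI PI.
  have pq : p * (2 * p)^-1 = 2^-1 by field.
  rewrite pq in bQ.
  have half01 : 0 <= (2^-1 : R) <= 1 by apply/andP; split; lra.
  have [_ /(_ erefl) m4] := D_critical_identity v m1 tG half01 bQ QI.
  by move: m5; rewrite m4.
apply: sup_le_ub.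
  (* The supremum bound requires a nonempty set; at parameter 0 the edge is almost surely closed. *)
  exists 0; split; first by rewrite lexx ler01.
  have b0 : bernoulli_percolation 0 (P 0) by apply: bP; rewrite lexx ler01.
  rewrite /percolation_prob (_ : P 0 _ = 0%E) //.
  apply/eqP; rewrite eq_le measure_ge0 andbT.
  apply: (@le_trans _ _ (P 0 (open_edge e))); last by rewrite b0.1.
  apply: le_measure; rewrite ?inE //; first exact: measurable_open_edge.
  by move=> w [].
move=> p /= [p01 f0]; apply: ub_le_sup.
  (* The set defining [p_h] is bounded above by 1/2. *)
  by exists 2^-1 => q /= [/andP[]].
split; first by rewrite (andP p01).1 p_half.
by have [] := D_critical_identity v m1 tG p01 (bP p p01) (null _ f0).
Qed.
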